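(* Let $K$ be a field, let $d\ge1$, let $\mathcal{O}$ be the simplicial order ideal of type $d$ in $\mathbb{T}^n$, and let $p=(0,\dots,0)$ be the monomial point of $\mathbb{B}_{\mathcal{O}}$. (a) If $n=2$ then $\mathbb{B}_{\mathcal{O}}$ is isomorphic to $\mathbb{A}^{(d+1)(d+2)}$. (b) If $n\ge3$ then $p$ is a singular point of $\mathbb{B}_{\mathcal{O}}$.
   Context: $\mathbb{T}^n$ is the set of terms (power products) in $x_1,\dots,x_n$. The simplicial order ideal of type $d\ge1$ is $\mathcal{O}=\{t\in\mathbb{T}^n\mid\deg(t)\le d\}=\{t_1,\dots,t_\mu\}$, with border $\partial\mathcal{O}=(x_1\mathcal{O}\cup\dots\cup x_n\mathcal{O})\setminus\mathcal{O}=\{b_1,\dots,b_\nu\}$. Let $c_{ij}$ ($1\le i\le\mu$, $1\le j\le\nu$) be indeterminates, $C=(c_{ij})$, $K[C]=K[c_{11},\dots,c_{\mu\nu}]$. The generic multiplication matrix $\mathcal{A}_r\in\mathrm{Mat}_\mu(K[C])$ ($r=1,\dots,n$) has $(i,j)$ entry $\delta_{im}$ if $x_rt_j=t_m\in\mathcal{O}$ and $c_{im}$ if $x_rt_j=b_m\in\partial\mathcal{O}$. $I(\mathbb{B}_{\mathcal{O}})$ is the ideal generated by the entries of all commutators $\mathcal{A}_k\mathcal{A}_\ell-\mathcal{A}_\ell\mathcal{A}_k$, and the $\mathcal{O}$-border basis scheme $\mathbb{B}_{\mathcal{O}}\subseteq\mathbb{A}^{\mu\nu}_K$ is the closed subscheme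 defined by $I(\mathbb{B}_{\mathcal{O}})$. The monomial point is the point of $\mathbb{B}_{\mathcal{O}}$ all of whose coordinates $c_{ij}$ are zero. *)

(* Defs.v *)
From HB Require Import structures.
From mathcomp Require Import all_boot all_order all_algebra.
From mathcomp Require Import boolp.
From mathcomp Require Import ring.
From mathcomp Require Import mpoly.

Set Implicit Arguments.
Unset Strict Implicit.
Unset Printing Implicit Defensive.

Import GRing.Theory.
Local Open Scope ring_scope.
Local Open Scope quotient_scope.

(* Regular local rings.  [idealr] and [prime_idealr] are proper ideals given by
   boolean predicates; since [boolp] makes every predicate boolean, they range
   over all proper, resp. all prime, ideals. *)

Section RegularLocalRings.
Variable R : comNzRingType.

Definition in_span k (g : 'I_k -> R) (x : R) : Prop :=
  exists a : 'I_k -> R, x = \sum_(i < k) a i * g i.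

(* The unit ideal, which is not an [idealr], is always finitely generated. *)
Definition noetherian : Prop :=
  forall J : idealr R, exists k (g : 'I_k -> R), forall x, x \in J <-> in_span g x.

Definition maximal_ideal (m : idealr R) : Prop :=
  forall J : idealr R, {subset m <= J} -> {subset J <= m}.

Definition unique_maximal_ideal (m : idealr R) : Prop :=
  maximal_ideal m /\ forall m' : idealr R, maximal_ideal m' -> m' =i m.

Definition ideal_square (m : idealr R) (x : R) : Prop :=
  exists k (u v : 'I_k -> R),
    (forall i, u i \in m /\ v i \in m) /\ x = \sum_(i < k) u i * v i.

(* dim_{R/m} (m/m^2) = e: the classes of x_1, ..., x_e form an R/m-basis. *)
Definition cotangent_dim (m : idealr R) (e : nat) : Prop :=
  exists x : 'I_e -> R,
    [/\ forall i, x i \in m,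
        forall y, y \in m ->
          exists a : 'I_e -> R, ideal_square m (y - \sum_(i < e) a i * x i)
      & forall a : 'I_e -> R,
          ideal_square m (\sum_(i < e) a i * x i) -> forall i, a i \in m].

Definition prime_chain (k : nat) (c : 'I_k.+1 -> prime_idealr R) : Prop :=
  forall i j : 'I_k.+1, (i < j)%N ->
    {subset c i <= c j} /\ ~ {subset c j <= c i}.

Definition krull_dim (k : nat) : Prop :=
  (exists c, @prime_chain k c) /\
  (forall l, (exists c, @prime_chain l c) -> (l <= k)%N).

Definition regular_local_ring : Prop :=
  noetherian /\
  exists2 m : idealr R, unique_maximal_ideal m &
    exists2 e : nat, cotangent_dim m e & krull_dim e.

End RegularLocalRings.

Section Localization.
Variables (A : comNzRingType) (P : prime_idealr A).

Definition denom : Type := {s : A | s \notin P}.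
HB.instance Definition _ := Choice.on denom.

Lemma one_notin : 1 \notin P. Proof. by rewrite idealr1. Qed.
Lemma mul_notin (s t : A) : s \notin P -> t \notin P -> s * t \notin P.
Proof. by move=> sP tP; rewrite prime_idealrM negb_or sP tP. Qed.

Definition one_denom : denom := exist _ 1 one_notin.
Definition mul_denom (s t : denom) : denom :=
  exist _ (sval s * sval t) (mul_notin (valP s) (valP t)).

Definition frac_eq (x y : A * denom) : bool :=
  `[< exists u : denom, sval u * (x.1 * sval y.2 - y.1 * sval x.2) = 0 >].

Lemma frac_eq_equiv : equiv_class_of frac_eq.
Proof.
split.
- by move=> x; apply/asboolP; exists one_denom; rewrite subrr mulr0.
- move=> x y; apply/asboolP/asboolP => -[u hu]; exists u;
    by rewrite -opprB mulrN hu oppr0.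
- move=> y x z /asboolP[u hu] /asboolP[v hv]; apply/asboolP.
  exists (mul_denom (mul_denom u v) y.2) => /=.
  set a := x.1 in hu *; set s := sval x.2 in hu *.
  set b := y.1 in hu hv; set t := sval y.2 in hu hv *.
  set c := z.1 in hv *; set w := sval z.2 in hv *.
  have -> : sval u * sval v * t * (a * w - c * s) =
    sval v * w * (sval u * (a * t - b * s)) +
    sval u * s * (sval v * (b * w - c * t))
    by ring.
  by rewrite hu hv !mulr0 addr0.
Qed.


Canonical frac_eq_equivrel := EquivRelPack frac_eq_equiv.
Canonical frac_eq_encModRel := defaultEncModRel frac_eq.

Definition localization : Type := {eq_quot frac_eq}.
HB.instance Definition _ : EqQuotient _ frac_eq localization :=
  EqQuotient.on localization.
HB.instance Definition _ := Choice.on localization.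

Definition frac (a : A) (s : denom) : localization := \pi_localization (a, s).

Lemma frac_eqP (a b : A) (s t : denom) :
  reflect (exists u : denom, sval u * (a * sval t - b * sval s) = 0)
          (frac a s == frac b t).
Proof. by rewrite /frac piE; apply: asboolP. Qed.

Lemma fracE (x : localization) : frac (repr x).1 (repr x).2 = x.
Proof. by rewrite /frac -surjective_pairing reprK. Qed.

Definition loc_add (x y : localization) : localization :=
  frac ((repr x).1 * sval (repr y).2 + (repr y).1 * sval (repr x).2)
       (mul_denom (repr x).2 (repr y).2).
Definition loc_mul (x y : localization) : localization :=
  frac ((repr x).1 * (repr y).1) (mul_denom (repr x).2 (repr y).2).
Definition loc_opp (x : localization) : localization :=
  frac (- (repr x).1) (repr x).2.
Definition loc_zero : localization := frac 0 one_denom.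
Definition loc_one : localization := frac 1 one_denom.

Lemma repr_frac (a : A) (s : denom) :
  exists u : denom,
    sval u * ((repr (frac a s)).1 * sval s - a * sval (repr (frac a s)).2) = 0.
Proof. by apply/frac_eqP; rewrite fracE. Qed.

Lemma loc_addE (a b : A) (s t : denom) :
  loc_add (frac a s) (frac b t) =
  frac (a * sval t + b * sval s) (mul_denom s t).
Proof.
have [u hu] := repr_frac a s; have [v hv] := repr_frac b t.
rewrite /loc_add; apply/eqP/frac_eqP; exists (mul_denom u v) => /=.
move: hu hv.
set a' := (repr _).1; set s' := sval (repr _).2.
set b' := (repr _).1; set t' := sval (repr _).2 => hu hv.
transitivity (sval v * t' * sval t * (sval u * (a' * sval s - a * s')) +
  sval u * s' * sval s * (sval v * (b' * sval t - b * t'))); first by ring.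
by rewrite hu hv !mulr0 addr0.
Qed.

Lemma loc_mulE (a b : A) (s t : denom) :
  loc_mul (frac a s) (frac b t) = frac (a * b) (mul_denom s t).
Proof.
have [u hu] := repr_frac a s; have [v hv] := repr_frac b t.
rewrite /loc_mul; apply/eqP/frac_eqP; exists (mul_denom u v) => /=.
move: hu hv.
set a' := (repr _).1; set s' := sval (repr _).2.
set b' := (repr _).1; set t' := sval (repr _).2 => hu hv.
transitivity (sval v * b' * sval t * (sval u * (a' * sval s - a * s')) +
  sval u * s' * a * (sval v * (b' * sval t - b * t'))); first by ring.
by rewrite hu hv !mulr0 addr0.
Qed.

Lemma loc_oppE (a : A) (s : denom) : loc_opp (frac a s) = frac (- a) s.
Proof.
have [u hu] := repr_frac a s.
rewrite /loc_opp; apply/eqP/frac_eqP; exists u => /=; move: hu.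
set a' := (repr _).1; set s' := sval (repr _).2 => hu.
by rewrite !mulNr -opprD mulrN hu oppr0.
Qed.

Lemma frac_congr (a b : A) (s t : denom) :
  a * sval t = b * sval s -> frac a s = frac b t.
Proof. by move=> e; apply/eqP/frac_eqP; exists one_denom; rewrite e subrr mulr0. Qed.

Lemma loc_addA : associative loc_add.
Proof.
move=> x y z; rewrite -(fracE x) -(fracE y) -(fracE z) !loc_addE.
by apply: frac_congr => /=; ring.
Qed.
Lemma loc_addC : commutative loc_add.
Proof.
move=> x y; rewrite -(fracE x) -(fracE y) !loc_addE.
by apply: frac_congr => /=; ring.
Qed.
Lemma loc_add0 : left_id loc_zero loc_add.
Proof.
by move=> x; rewrite -(fracE x) loc_addE; apply: frac_congr => /=; ring.
Qed.
Lemma loc_addN : left_inverse loc_zero loc_opp loc_add.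
Proof.
move=> x; rewrite -(fracE x) loc_oppE loc_addE.
by apply: frac_congr => /=; ring.
Qed.
HB.instance Definition _ :=
  GRing.isZmodule.Build localization loc_addA loc_addC loc_add0 loc_addN.

Lemma loc_mulA : associative loc_mul.
Proof.
move=> x y z; rewrite -(fracE x) -(fracE y) -(fracE z) !loc_mulE.
by apply: frac_congr => /=; ring.
Qed.
Lemma loc_mulC : commutative loc_mul.
Proof.
move=> x y; rewrite -(fracE x) -(fracE y) !loc_mulE.
by apply: frac_congr => /=; ring.
Qed.
Lemma loc_mul1 : left_id loc_one loc_mul.
Proof.
by move=> x; rewrite -(fracE x) loc_mulE; apply: frac_congr => /=; ring.
Qed.
Lemma loc_mulDl : left_distributive loc_mul loc_add.
Proof.
move=> x y z; rewrite -(fracE x) -(fracE y) -(fracE z).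
rewrite !(loc_addE, loc_mulE).
by apply: frac_congr => /=; ring.
Qed.
Lemma loc_one_neq0 : loc_one != loc_zero.
Proof.
apply/frac_eqP => -[u /=].
rewrite mul0r subr0 !mulr1 => u0.
by have := valP u; rewrite /= u0 idealr0.
Qed.
HB.instance Definition _ :=
  GRing.Zmodule_isComNzRing.Build localization
    loc_mulA loc_mulC loc_mul1 loc_mulDl loc_one_neq0.

End Localization.

Section BorderBasisScheme.
Variables (K : fieldType) (n : nat).

Section Generic.
Variable O : seq 'X_{1..n}.

Definition border : seq 'X_{1..n} :=
  undup [seq x <- [seq (U_(r) + t)%MM | r <- enum 'I_n, t <- O] | x \notin O].

Local Notation mu := (size O).
Local Notation nu := (size border).

Definition indet (i : 'I_mu) (j : 'I_nu) : {mpoly K[mu * nu]} :=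
  'X_(mxvec_index i j).

(* [border] is duplicate-free, so the sum has the single term [indet i m] with
   x_r t_j = b_m. *)
Definition mult_matrix (r : 'I_n) : 'M[{mpoly K[mu * nu]}]_mu :=
  \matrix_(i, j)
    let x := (U_(r) + tnth (in_tuple O) j)%MM in
    if x \in O then (tnth (in_tuple O) i == x)%:R
    else \sum_(m < nu | tnth (in_tuple border) m == x) indet i m.

Definition commutator (k l : 'I_n) : 'M[{mpoly K[mu * nu]}]_mu :=
  mult_matrix k *m mult_matrix l - mult_matrix l *m mult_matrix k.

Definition in_border_ideal (f : {mpoly K[mu * nu]}) : Prop :=
  exists a : 'I_n -> 'I_n -> 'I_mu -> 'I_mu -> {mpoly K[mu * nu]},
    f = \sum_k \sum_l \sum_i \sum_j a k l i j * commutator k l i j.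

End Generic.

Variable d : nat.

Definition simplicial : seq 'X_{1..n} :=
  [seq bmnm t | t <- enum {: 'X_{1..n < d.+1}}].

Lemma mem_simplicial t : (t \in simplicial) = (mdeg t <= d)%N.
Proof.
apply/mapP/idP => [[u _ ->]|ht]; first by rewrite -ltnS bmdeg.
by exists (BMultinom (n := n) (bound := d.+1) (bmnm := t) ht); rewrite ?mem_enum.
Qed.

Lemma simplicial_uniq : uniq simplicial.
Proof. by rewrite map_inj_uniq ?enum_uniq //; apply: val_inj. Qed.

Local Notation O := simplicial.
Local Notation mu := (size O).
Local Notation nu := (size (border O)).

Definition origin : 'I_(mu * nu) -> K := fun=> 0.

Lemma mult_matrix_origin r (i j : 'I_mu) :
  (mult_matrix O r i j).@[origin] =
  let x := (U_(r) + tnth (in_tuple O) j)%MM in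
  ((x \in O) && (tnth (in_tuple O) i == x))%:R.
Proof.
rewrite mxE /=; case: ifP => hx /=.
  by case: eqP; rewrite ?mevalC ?meval1 ?meval0 // rmorph1.
rewrite raddf_sum big1 // => m _.
by rewrite /indet /= mevalXU.
Qed.

Lemma mult_matrix_origin_mul k l (i j : 'I_mu) :
  ((mult_matrix O k *m mult_matrix O l) i j).@[origin] =
  let x := (U_(k) + U_(l) + tnth (in_tuple O) j)%MM in
  ((x \in O) && (tnth (in_tuple O) i == x))%:R.
Proof.
rewrite mxE raddf_sum /=.
under eq_bigr => m _ do rewrite rmorphM /= !mult_matrix_origin /=.
set y := tnth (in_tuple O) j.
case hl: (U_(l) + y \in O)%MM; last first.
  rewrite big1; last by move=> m _; rewrite /= mulr0.
  suff -> : (U_(k) + U_(l) + y \in O)%MM = false by [].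
  apply/negP => h; move/negP: hl; apply; move: h.
  by rewrite !mem_simplicial -addmA mdegD => h; apply: leq_trans h; rewrite leq_addl.
have [m0 hm0] : exists m0 : 'I_mu, tnth (in_tuple O) m0 = (U_(l) + y)%MM.
  have /tnthP[m ->] : (U_(l) + y)%MM \in in_tuple O by [].
  by exists m.
rewrite (bigD1 m0) //= big1 => [|m hm]; last first.
  have -> : (tnth (in_tuple O) m == U_(l) + y)%MM = false; last first.
    by rewrite mulr0.
  apply: contraNF hm; rewrite -hm0 => /eqP e.
  exact/eqP/(@tuple_uniqP _ _ (in_tuple O) simplicial_uniq).
by rewrite hm0 eqxx mulr1 addr0 addmA.
Qed.

(* The monomial point lies on the border basis scheme. *)
Lemma border_ideal_origin (f : {mpoly K[mu * nu]}) :
  in_border_ideal f -> f.@[origin] = 0.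
Proof.
case=> a ->; rewrite raddf_sum big1 // => k _; rewrite raddf_sum big1 // => l _.
rewrite raddf_sum big1 // => i _; rewrite raddf_sum big1 // => j _ /=.
rewrite rmorphM /= /commutator mxE [X in _ + X]mxE rmorphB /=.
by rewrite !mult_matrix_origin_mul /= [(U_(l) + U_(k))%MM]addmC subrr mulr0.
Qed.

Definition border_ideal : {pred {mpoly K[mu * nu]}} :=
  fun f => `[< in_border_ideal f >].

Lemma border_idealP f : reflect (in_border_ideal f) (f \in border_ideal).
Proof. exact: asboolP. Qed.

Lemma border_ideal_closed : idealr_closed border_ideal.
Proof.
split.
- apply/border_idealP; exists (fun _ _ _ _ => 0).
  by do 4!(rewrite big1 // => ? _); rewrite mul0r.
- apply/border_idealP => /border_ideal_origin /eqP.
  by rewrite rmorph1 oner_eq0.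
- move=> c f g /border_idealP[a ->] /border_idealP[b ->].
  apply/border_idealP; exists (fun k l i j => c * a k l i j + b k l i j).
  do 4!(rewrite mulr_sumr -big_split /=; apply: eq_bigr => ? _).
  by rewrite mulrDl mulrA.
Qed.

HB.instance Definition _ :=
  isIdealr.Build {mpoly K[mu * nu]} border_ideal border_ideal_closed.

(* K[C] / I(B_O), so that the border basis scheme is its spectrum. *)
Definition coord_ring : Type := {ideal_quot border_ideal}.
HB.instance Definition _ := GRing.ComNzRing.on coord_ring.

Definition proj : {mpoly K[mu * nu]} -> coord_ring := \pi_{ideal_quot border_ideal}.
HB.instance Definition _ := GRing.RMorphism.on proj.

Definition coord_scale (c : K) (x : coord_ring) : coord_ring :=
  proj c%:MP * x.

Lemma coord_scaleA a b x : coord_scale a (coord_scale b x) = coord_scale (a * b) x.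
Proof. by rewrite /coord_scale mulrA -rmorphM /= mpolyCM. Qed.
Lemma coord_scale1 : left_id 1 coord_scale.
Proof. by move=> x; rewrite /coord_scale rmorph1 mul1r. Qed.
Lemma coord_scaleDr : right_distributive coord_scale +%R.
Proof. by move=> c x y; rewrite /coord_scale mulrDr. Qed.
Lemma coord_scaleDl x : {morph coord_scale^~ x : a b / a + b}.
Proof. by move=> a b; rewrite /coord_scale mpolyCD rmorphD mulrDl. Qed.
HB.instance Definition _ :=
  GRing.Zmodule_isLmodule.Build K coord_ring
    coord_scaleA coord_scale1 coord_scaleDr coord_scaleDl.

Lemma coord_scaleAl (c : K) (x y : coord_ring) : c *: (x * y) = c *: x * y.
Proof. exact: mulrA. Qed.
HB.instance Definition _ :=
  GRing.Lmodule_isLalgebra.Build K coord_ring coord_scaleAl.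

Definition eval_origin (x : coord_ring) : K := (repr x).@[origin].

Lemma eval_originE f : eval_origin (proj f) = f.@[origin].
Proof.
have : proj (repr (proj f)) = proj f by exact: reprK.
move=> /eqP; rewrite -Quotient.idealrBE => /border_idealP/border_ideal_origin.
by rewrite rmorphB /= => /eqP; rewrite subr_eq0 => /eqP.
Qed.

Definition origin_ideal : {pred coord_ring} := fun x => eval_origin x == 0.

Lemma proj_repr x : proj (repr x) = x. Proof. exact: reprK. Qed.

Lemma origin_ideal_closed : idealr_closed origin_ideal.
Proof.
split.
- by rewrite unfold_in -[0](rmorph0 proj) eval_originE rmorph0.
- by rewrite unfold_in -[1](rmorph1 proj) eval_originE rmorph1 oner_eq0.
- move=> a u v; rewrite !unfold_in.
  rewrite -(proj_repr a) -(proj_repr u) -(proj_repr v).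
  rewrite -rmorphM -rmorphD !eval_originE rmorphD rmorphM /=.
  by move=> /eqP -> /eqP ->; rewrite mulr0 addr0.
Qed.
HB.instance Definition _ :=
  isIdealr.Build coord_ring origin_ideal origin_ideal_closed.

Lemma origin_ideal_prime : prime_idealr_closed origin_ideal.
Proof.
move=> u v; rewrite !unfold_in -(proj_repr u) -(proj_repr v).
by rewrite -rmorphM !eval_originE rmorphM mulf_eq0.
Qed.
HB.instance Definition _ :=
  isPrimeIdealrClosed.Build coord_ring origin_ideal origin_ideal_prime.

(* The stalk of the structure sheaf at the monomial point. *)
Definition monomial_point_local_ring : comNzRingType :=
  localization origin_ideal.

Definition monomial_point_singular : Prop :=
  ~ regular_local_ring monomial_point_local_ring.

End BorderBasisScheme.

(* Main.v *)
Require Import Defs.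
From HB Require Import structures.
From mathcomp Require Import all_boot all_order all_algebra.
From mathcomp Require Import boolp mpoly zify ring.

Set Implicit Arguments.
Unset Strict Implicit.
Unset Printing Implicit Defensive.

Import GRing.Theory.
Local Open Scope ring_scope.

(** Write c(s, b) for the coordinate attached to a term s of degree at most d
    and a border term b, that is, a term of degree d + 1.  In the column of a
    term t of degree less than d the two products of multiplication matrices
    agree identically, so the equations of the scheme are the ones in the
    columns of the terms t of degree d:
      c(p / x_k, x_l t) + sum_u c(p, x_k u) c(u, x_l t)
    is symmetric in k and l, where u runs over the terms of degree d and the
    first summand is 0 when x_k does not divide p ([top_product_sym],
    [commutators_eq0]).  Both halves rest on these equations.

    Two variables.  Let b_j = x^(d+1-j) y^j and g_j = b_j - sum_s c(s, b_j) s.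
    The equations say exactly that
      y g_j - x g_(j+1) = sum_k a_jk g_k    (0 <= j <= d)
    for some constants a_jk, and comparing coefficients in degree d + 1 shows
    that the a_jk are polynomials, even linear, in the c(s, b).  So a point of
    the scheme yields a (d+1) x (d+2) matrix a.  Conversely every matrix a
    comes from exactly one point.  The signed maximal minors of the matrix
    with entries y [j = k] - x [j + 1 = k] - a_jk satisfy the relations, and
    the j-th one has leading form b_j ([exists_syzygy], by the Hilbert-Burch
    argument).  The relations determine the coefficients of the g_j degree by
    degree ([syzygy_unique]), since y h_j = x h_(j+1) for all j has no
    solution in forms of degree at most d but 0.  As uniqueness holds over
    every commutative ring, the two constructions are inverse isomorphisms of
    coordinate rings ([coord_ring_plane]).

    Three or more variables.  Call c(s, b) of top degree if deg s = d, and let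
    N be the number of these coordinates.  Each of them spans a tangent
    direction at the origin, because every monomial of the equations contains
    two coordinates of top degree or one of lower degree; hence the cotangent
    space of the local ring has dimension at least N ([cotangent_dim_top]).
    The equations express c(s, b) with deg s < d through coordinates with s of
    larger degree, so the N coordinates of top degree generate the coordinate
    ring ([of_top_surj]).  With three variables there are two different such
    expressions for one and the same coordinate, and their difference is a
    nonzero polynomial relation between the generators ([top_relation]).  An
    algebra generated by N elements that satisfy a nontrivial relation has
    dimension less than N, and so has its localization ([no_long_chain]).  A
    regular local ring of cotangent dimension e >= N would have a chain of
    primes of length e, which is a contradiction ([singular_of_three]). *)

(** * Coordinates of the border basis scheme and the commutator equations *)

Lemma eq_rmorph_mpoly (K : nzRingType) (m : nat) (R : nzRingType)
    (f g : {rmorphism {mpoly K[m]} -> R}) :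
  (forall c, f c%:MP = g c%:MP) -> (forall i, f 'X_i = g 'X_i) -> f =1 g.
Proof.
move=> fgC fgX p; rewrite (mpolyE p) !rmorph_sum /=; apply: eq_bigr => k _.
rewrite -mul_mpolyC !rmorphM fgC /= mpolyXE_id !rmorph_prod; congr (_ * _).
by apply: eq_bigr => i _; rewrite !rmorphXn fgX.
Qed.

Section PairIndexedVariables.
Variables (K : fieldType) (T : eqType) (P Q : seq T).
Local Notation poly := {mpoly K[size P * size Q]}.

(** Indexing variables by the entries of [P] and [Q] instead of by their positions
    lets the equations below speak about terms; outside [P] and [Q] the value is 0. *)
Definition var (s b : T) : poly :=
  \sum_(i | tnth (in_tuple P) i == s) \sum_(j | tnth (in_tuple Q) j == b)
    'X_(mxvec_index i j).

Definition point (R : Type) (g : T -> T -> R) (k : 'I_(size P * size Q)) : R :=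
  mxvec (\matrix_(i, j) g (tnth (in_tuple P) i) (tnth (in_tuple Q) j)) 0 k.

Lemma pointE (R : Type) (g : T -> T -> R) i j :
  point g (mxvec_index i j) = g (tnth (in_tuple P) i) (tnth (in_tuple Q) j).
Proof. by rewrite /point mxvecE mxE. Qed.

Lemma varNr s b : b \notin Q -> var s b = 0.
Proof.
move=> bQ; rewrite /var big1 // => i _; rewrite big_pred0 // => j.
by apply: contraNF bQ => /eqP <-; exact: mem_tnth.
Qed.

Hypotheses (uP : uniq P) (uQ : uniq Q).

Lemma tnth_uniq_eq (s : seq T) (us : uniq s) (i j : 'I_(size s)) :
  (tnth (in_tuple s) i == tnth (in_tuple s) j) = (i == j).
Proof. by apply/eqP/eqP => [/(@tuple_uniqP _ _ (in_tuple s) us)|->]. Qed.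

Lemma var_tnth i j :
  var (tnth (in_tuple P) i) (tnth (in_tuple Q) j) = 'X_(mxvec_index i j).
Proof.
rewrite /var (big_pred1 i) => [|i']; last by rewrite tnth_uniq_eq.
by rewrite (big_pred1 j) // => j'; rewrite tnth_uniq_eq.
Qed.

Lemma var_index s b : s \in P -> b \in Q ->
  exists i j, [/\ tnth (in_tuple P) i = s, tnth (in_tuple Q) j = b
                & var s b = 'X_(mxvec_index i j)].
Proof.
move=> /(tnthP (in_tuple P))[i ->] /(tnthP (in_tuple Q))[j ->].
by exists i, j; rewrite var_tnth.
Qed.

Lemma mmap_var (R : comNzRingType) (h : {rmorphism K -> R}) (g : T -> T -> R) s b :
  s \in P -> b \in Q -> mmap h (point g) (var s b) = g s b.
Proof.
move=> sP bQ; have [i [j [<- <- ->]]] := var_index sP bQ.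
by rewrite mmapX mmap1U pointE.
Qed.

Lemma eq_rmorph_var (R : comNzRingType) (f g : {rmorphism poly -> R}) :
  (forall c, f c%:MP = g c%:MP) ->
  (forall s b, s \in P -> b \in Q -> f (var s b) = g (var s b)) -> f =1 g.
Proof.
move=> fgC fgX; apply: eq_rmorph_mpoly => // k.
by case/mxvec_indexP: k => i j; rewrite -var_tnth fgX ?mem_tnth.
Qed.

End PairIndexedVariables.

Section Commutation.
Variables (K : fieldType) (n d : nat).
Local Notation O := (simplicial n d).
Local Notation B := (border O).
Local Notation KC := {mpoly K[size O * size B]}.
Local Notation cvar := (var K O B).
Local Notation mon := 'X_{1..n}.

Lemma mem_border t : (t \in B) = (mdeg t == d.+1).
Proof.
rewrite mem_undup mem_filter mem_simplicial -ltnNge.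
apply/andP/eqP => [[dt /allpairsP[[r u] /= [_ ut tE]]]|dt].
  rewrite mem_simplicial in ut; move: dt; rewrite tE mdegD mdeg1 add1n ltnS => dt.
  by apply/eqP; rewrite eqSS eqn_leq dt andbT.
split; first by rewrite dt.
have [r tr] : exists r, t r != 0%N.
  apply/existsP; rewrite -negb_forall; apply/negP => /forallP t0.
  suff: mdeg t = 0%N by rewrite dt.
  by rewrite mdegE big1 // => i _; apply/eqP.
apply/allpairsP; exists (r, (t - U_(r))%MM) => /=.
have le : (U_(r) <= t)%MM by rewrite lep1mP.
have e : t = (U_(r) + (t - U_(r)))%MM by rewrite addmC submK.
split=> //; rewrite ?mem_enum // mem_simplicial -ltnS -dt {2}e mdegD mdeg1.
by rewrite add1n.
Qed.

Lemma border_uniq : uniq B. Proof. exact: undup_uniq. Qed.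

(** Used to see a single commutator entry as an element of the border ideal. *)
Lemma sum4_delta (R : nzRingType) (I1 I2 I3 I4 : finType) (k : I1) (l : I2) (i : I3)
    (j : I4) (F : I1 -> I2 -> I3 -> I4 -> R) :
  \sum_k' \sum_l' \sum_i' \sum_j'
    [&& k' == k, l' == l, i' == i & j' == j]%:R * F k' l' i' j' = F k l i j.
Proof.
rewrite (bigD1 k) //= [X in _ + X]big1 ?addr0; last first.
  move=> k' /negbTE hk; rewrite big1 // => l' _; rewrite big1 // => i' _.
  by rewrite big1 // => j' _; rewrite hk mul0r.
rewrite (bigD1 l) //= [X in _ + X]big1 ?addr0; last first.
  move=> l' /negbTE hl; rewrite big1 // => i' _.
  by rewrite big1 // => j' _; rewrite hl andbF mul0r.
rewrite (bigD1 i) //= [X in _ + X]big1 ?addr0; last first.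
  by move=> i' /negbTE hi; rewrite big1 // => j' _; rewrite hi !andbF mul0r.
rewrite (bigD1 j) //= [X in _ + X]big1 ?addr0; last first.
  by move=> j' /negbTE hj; rewrite hj !andbF mul0r.
by rewrite !eqxx mul1r.
Qed.

Section Generic.
Variables (R : comNzRingType) (h : {rmorphism KC -> R}).
Local Notation g := (fun s b => h (cvar s b)).

(** The entry in row [p] and column [u] of the multiplication matrix by the [r]-th
    variable, specialized along [h]. *)
Definition entry (r : 'I_n) (p u : mon) : R :=
  if (mdeg u < d)%N then (p == U_(r) + u)%MM%:R else g p (U_(r) + u)%MM.

Lemma rmorph_mult_matrix r i j :
  h (mult_matrix K O r i j) = entry r (tnth (in_tuple O) i) (tnth (in_tuple O) j).
Proof.
rewrite mxE /entry mem_simplicial mdegD mdeg1 add1n; case: ltnP => hx /=.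
  by rewrite rmorph_nat.
congr (h _); rewrite /var (big_pred1 i) => [|i' /=]; last first.
  by rewrite tnth_uniq_eq ?simplicial_uniq.
by [].
Qed.

Definition top_terms := [seq u <- O | mdeg u == d].

Lemma mem_top_terms u : (u \in top_terms) = (mdeg u == d).
Proof.
by rewrite mem_filter mem_simplicial; case: eqP => //= ->; rewrite leqnn.
Qed.

Lemma top_uniq : uniq top_terms.
Proof. by rewrite filter_uniq ?simplicial_uniq. Qed.

(** If [f] lists the coefficients of a polynomial, this lists those of its product
    with the [r]-th variable. *)
Definition quot_coef (r : 'I_n) (f : mon -> R) (p : mon) : R :=
  if p r == 0%N then 0 else f (p - U_(r))%MM.

Lemma sum_delta (s : seq mon) (F : mon -> R) (u0 : mon) : uniq s ->
  \sum_(u <- s) (u == u0)%:R * F u = if u0 \in s then F u0 else 0.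
Proof.
move=> us; case: ifP => u0s.
  rewrite (bigD1_seq u0) //= eqxx mul1r big1 ?addr0 // => u /negbTE ->.
  by rewrite mul0r.
rewrite big_seq big1 // => u us'; case: eqP => [eu|_]; last by rewrite mul0r.
by rewrite -eu us' in u0s.
Qed.

Lemma product_entryE k l i j :
  h ((mult_matrix K O k *m mult_matrix K O l) i j) =
  \sum_(u <- O) entry k (tnth (in_tuple O) i) u * entry l u (tnth (in_tuple O) j).
Proof.
rewrite mxE rmorph_sum [RHS]big_tnth; apply: eq_bigr => m _.
by rewrite rmorphM /= !rmorph_mult_matrix.
Qed.

(** In low degree multiplication by the [l]-th variable stays inside the order ideal,
    so the inner matrix only moves the column. *)
Lemma product_low k l p t : (mdeg t < d)%N ->
  \sum_(u <- O) entry k p u * entry l u t = entry k p (U_(l) + t)%MM.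
Proof.
move=> td; rewrite (eq_bigr (fun u => (u == U_(l) + t)%MM%:R * entry k p u)).
  rewrite sum_delta ?simplicial_uniq // mem_simplicial mdegD mdeg1.
  by rewrite add1n td.
by move=> u _; rewrite mulrC /entry td.
Qed.

Lemma entry_low_sym k l p t : (mdeg t < d)%N ->
  entry k p (U_(l) + t)%MM = entry l p (U_(k) + t)%MM.
Proof. by move=> td; rewrite /entry !mdegD !mdeg1 !addmA [(U_(k) + _)%MM]addmC. Qed.

(** The product of the [k]-th and [l]-th matrices in a column of degree [d].  The sum
    over the terms [u] of degree less than [d] collapses to the one with [x_k u = p]. *)
Definition top_product (k l : 'I_n) (p t : mon) : R :=
  quot_coef k (g^~ (U_(l) + t)%MM) p +
  \sum_(u <- top_terms) g p (U_(k) + u)%MM * g u (U_(l) + t)%MM.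

Lemma product_top k l p t : (mdeg p <= d)%N -> mdeg t = d ->
  \sum_(u <- O) entry k p u * entry l u t = top_product k l p t.
Proof.
move=> pd td; rewrite (bigID (fun u => mdeg u == d)) /= addrC; congr (_ + _); last first.
  rewrite /top_terms big_filter; apply: eq_bigr => u /eqP ud.
  by rewrite /entry ud td ltnn.
rewrite /quot_coef; case: eqP => pk.
  rewrite big1_seq // => u /andP[ud uO]; rewrite mem_simplicial in uO.
  rewrite /entry ltn_neqAle ud uO /=; case: eqP => [pu|_]; last by rewrite mul0r.
  by move: pk; rewrite pu mnmDE mnm1E eqxx.
have le : (U_(k) <= p)%MM by rewrite lep1mP; apply/eqP.
have pE : p = (U_(k) + (p - U_(k)))%MM by rewrite addmC submK.
have dp : (mdeg (p - U_(k)) < d)%N.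
  by move: pd; rewrite {1}pE mdegD mdeg1 add1n.
rewrite big_seq_cond (eq_bigr (fun u => (u == p - U_(k))%MM%:R * g u (U_(l) + t)%MM)).
  rewrite -big_seq_cond -big_filter sum_delta ?filter_uniq ?simplicial_uniq //.
  by rewrite mem_filter mem_simplicial (ltnW dp) neq_ltn dp.
move=> u /andP[uO ud]; rewrite mem_simplicial in uO.
rewrite /entry td ltnn ltn_neqAle ud uO /= {1}pE eqm_add2l.
by rewrite [(p - _)%MM == u]eq_sym.
Qed.

Lemma commutator_top k l i j : mdeg (tnth (in_tuple O) j) = d ->
  h (commutator K O k l i j) =
  top_product k l (tnth (in_tuple O) i) (tnth (in_tuple O) j) -
  top_product l k (tnth (in_tuple O) i) (tnth (in_tuple O) j).
Proof.
move=> jd; have iO : (mdeg (tnth (in_tuple O) i) <= d)%N.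
  by rewrite -mem_simplicial mem_tnth.
rewrite /commutator mxE [X in _ + X]mxE rmorphB (product_entryE k) (product_entryE l).
by rewrite (product_top k) ?(product_top l).
Qed.

Lemma commutator_low k l i j : (mdeg (tnth (in_tuple O) j) < d)%N ->
  h (commutator K O k l i j) = 0.
Proof.
move=> jd; rewrite /commutator mxE [X in _ + X]mxE rmorphB (product_entryE k) (product_entryE l).
by rewrite (product_low k) ?(product_low l) // entry_low_sym // subrr.
Qed.

(** To kill the border ideal, a homomorphism only has to satisfy the quadratic
    equations in the columns of degree [d]. *)
Lemma commutators_eq0 :
  (forall k l p t, (mdeg p <= d)%N -> mdeg t = d ->
     top_product k l p t = top_product l k p t) ->
  forall f, in_border_ideal f -> h f = 0.
Proof.
move=> hcomm f [a ->]; rewrite rmorph_sum big1 // => k _; rewrite rmorph_sum big1 // => l _.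
rewrite rmorph_sum big1 // => i _; rewrite rmorph_sum big1 // => j _.
rewrite rmorphM; have := mem_tnth j (in_tuple O); rewrite mem_simplicial.
rewrite leq_eqVlt => /orP[/eqP jd|/commutator_low ->]; last by rewrite mulr0.
rewrite commutator_top // hcomm ?subrr ?mulr0 //.
by rewrite -mem_simplicial mem_tnth.
Qed.

Lemma top_product_sym :
  (forall f : KC, in_border_ideal f -> h f = 0) ->
  forall k l p t, (mdeg p <= d)%N -> mdeg t = d ->
     top_product k l p t = top_product l k p t.
Proof.
move=> hI k l p t pd td.
have /(tnthP (in_tuple O))[i pE] : p \in O by rewrite mem_simplicial.
have /(tnthP (in_tuple O))[j tE] : t \in O by rewrite mem_simplicial td.
apply/eqP; rewrite -subr_eq0 pE tE -commutator_top -?tE //; apply/eqP/hI.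
exists (fun k' l' i' j' => [&& k' == k, l' == l, i' == i & j' == j]%:R).
by rewrite sum4_delta.
Qed.

End Generic.
End Commutation.

Opaque var.

(** * Terms in two variables and their syzygies *)

Lemma subr_swap (V : zmodType) (a b c e : V) : a - b = c - e -> a - c = b - e.
Proof.
by move=> h; rewrite -[a](subrK b) h addrAC [c - e - c]addrAC subrr add0r addrC.
Qed.

Section TwoVariables.
Variable d : nat.
Local Notation mon := 'X_{1..2}.
Let x : 'I_2 := ord0.
Let y : 'I_2 := ord_max.

Definition xy (i j : nat) : mon := (U_(x) *+ i + U_(y) *+ j)%MM.

Lemma xy_x i j : xy i j x = i.
Proof. by rewrite mnmDE !mulmnE !mnm1E /= mul1n mul0n addn0. Qed.
Lemma xy_y i j : xy i j y = j.
Proof. by rewrite mnmDE !mulmnE !mnm1E /= mul1n mul0n. Qed.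

Lemma ord2_ind (P : 'I_2 -> Prop) : P x -> P y -> forall i, P i.
Proof.
move=> Px Py [[|[|//]] hi].
  by rewrite (_ : Ordinal hi = x) //; apply: val_inj.
by rewrite (_ : Ordinal hi = y) //; apply: val_inj.
Qed.

Lemma xy_eta (p : mon) : p = xy (p x) (p y).
Proof. by apply/mnmP; apply: ord2_ind; rewrite ?xy_x ?xy_y. Qed.

Lemma mdeg_xy i j : mdeg (xy i j) = (i + j)%N.
Proof. by rewrite mdegD !mdegMn !mdeg1 !mul1n. Qed.

Lemma mdeg2 (p : mon) : mdeg p = (p x + p y)%N.
Proof. by rewrite {1}(xy_eta p) mdeg_xy. Qed.

Lemma addx i j : (U_(x) + xy i j)%MM = xy i.+1 j.
Proof. by rewrite /xy mulmS addmA. Qed.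
Lemma addy i j : (U_(y) + xy i j)%MM = xy i j.+1.
Proof. by rewrite /xy mulmS addmA [(U_(y) + _)%MM]addmC -addmA. Qed.

Lemma quot_x (R : comNzRingType) (f : mon -> R) i j :
  quot_coef x f (xy i j) = if i is i'.+1 then f (xy i' j) else 0.
Proof.
rewrite /quot_coef xy_x; case: i => //= i; congr f.
by rewrite -addx addmC addmK.
Qed.
Lemma quot_y (R : comNzRingType) (f : mon -> R) i j :
  quot_coef y f (xy i j) = if j is j'.+1 then f (xy i j') else 0.
Proof.
rewrite /quot_coef xy_y; case: j => //= j; congr f.
by rewrite -addy addmC addmK.
Qed.

Definition border_term (j : nat) : mon := xy (d.+1 - j) j.
Definition top_term (j : nat) : mon := xy (d - j) j.

Lemma quot_x_border (R : comNzRingType) (f : mon -> R) j :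
  (j <= d)%N -> quot_coef x f (border_term j) = f (top_term j).
Proof. by move=> jd; rewrite /border_term subSn // quot_x. Qed.
Lemma quot_y_border (R : comNzRingType) (f : mon -> R) j :
  quot_coef y f (border_term j.+1) = f (top_term j).
Proof. by rewrite /border_term subSS quot_y. Qed.

Lemma top_terms_perm : perm_eq (top_terms 2 d) [seq top_term (i : 'I_d.+1) | i <- enum 'I_d.+1].
Proof.
apply: uniq_perm.
- by rewrite filter_uniq ?simplicial_uniq.
- rewrite map_inj_uniq ?enum_uniq // => i j /(congr1 (fun m : mon => m y)).
  by rewrite !xy_y => /val_inj.
move=> u; rewrite mem_top_terms; apply/eqP/mapP => [ud|[i _ ->]].
  have uy : (u y < d.+1)%N by rewrite ltnS -ud mdeg2 leq_addl.
  exists (Ordinal uy); rewrite ?mem_enum //= /top_term /= -ud mdeg2 addnK; exact: xy_eta.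
by rewrite mdeg_xy subnK // -ltnS.
Qed.

Section Syzygies.
Variable R : comNzRingType.

(** With [G j] the coefficients of a polynomial [g_j], these are the coefficients, up to
    degree [d + 1], of [y g_j - x g_(j+1) = sum_k a_jk g_k]. *)
Definition syzygy (a : nat -> nat -> R) (G : nat -> mon -> R) :=
  forall j p, (j <= d)%N -> (mdeg p <= d.+1)%N ->
    quot_coef y (G j) p - quot_coef x (G j.+1) p = \sum_(k < d.+2) a j k * G k p.

Definition syz_coef (G : nat -> mon -> R) j k :=
  quot_coef y (G j) (border_term k) - quot_coef x (G j.+1) (border_term k).

Definition monic_border (G : nat -> mon -> R) :=
  forall j k, (j <= d.+1)%N -> (k <= d.+1)%N -> G j (border_term k) = (j == k)%:R.

Lemma border_termE (p : mon) : mdeg p = d.+1 -> p = border_term (p y) /\ (p y <= d.+1)%N.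
Proof.
move=> pd; rewrite /border_term -pd mdeg2 addnK leq_addl; split=> //; exact: xy_eta.
Qed.

(** Since [g_k] has the single term [b_k] in degree [d + 1], the coefficient of [b_k] in
    the relation reads off [a_jk]. *)
Lemma syzygy_coef a G j k : syzygy a G -> monic_border G ->
  (j <= d)%N -> (k <= d.+1)%N -> a j k = syz_coef G j k.
Proof.
move=> aG bG jd kd; rewrite /syz_coef aG //; last by rewrite mdeg_xy subnK.
rewrite (bigD1 (inord k)) //= inordK // bG // eqxx mulr1 big1 ?addr0 // => i ik.
rewrite bG ?leq_ord //; case: eqP => [ki|_]; last by rewrite mulr0.
by move: ik; rewrite -ki inord_val eqxx.
Qed.

Lemma eq_syzygy a a' G :
  (forall j k, (j <= d)%N -> (k <= d.+1)%N -> a j k = a' j k) ->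
  syzygy a G -> syzygy a' G.
Proof.
move=> aa' aG j p jd pd; rewrite aG //; apply: eq_bigr => k _.
by rewrite aa' ?leq_ord.
Qed.

(** Descending induction on the degree: if the differences [h_j = g_j - g'_j] vanish in
    degree [e + 1], then [y h_j = x h_(j+1)] in that degree.  Following a coefficient of
    [h_j] of degree [e <= d] along these equalities, upwards or downwards in [j], trades
    [x] for [y] or back until a term not divisible by the required variable is met; one of
    the two directions gets there before [j] leaves its range. *)
Lemma syzygy_unique a G G' : syzygy a G -> syzygy a G' ->
  (forall j p, (j <= d.+1)%N -> mdeg p = d.+1 -> G j p = G' j p) ->
  forall j p, (j <= d.+1)%N -> (mdeg p <= d.+1)%N -> G j p = G' j p.
Proof.
move=> aG aG' top.
suff H e : forall j p, (j <= d.+1)%N -> (mdeg p + e)%N = d.+1 -> G j p = G' j p.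
  by move=> j p jd pd; apply: (H (d.+1 - mdeg p)%N) => //; rewrite subnKC.
elim: e => [|e IHe] j p jd; first by rewrite addn0; exact: top.
rewrite addnS => -[pd].
pose H j p := G j p - G' j p.
have HE k q0 q1 : (k <= d)%N -> (q0 + q1 + e)%N = d.+1 ->
    quot_coef y (H k) (xy q0 q1) = quot_coef x (H k.+1) (xy q0 q1).
  move=> kd qd; have qle : (mdeg (xy q0 q1) <= d.+1)%N by rewrite mdeg_xy; lia.
  have : \sum_(i < d.+2) a k i * G i (xy q0 q1) = \sum_(i < d.+2) a k i * G' i (xy q0 q1).
    by apply: eq_bigr => i _; rewrite (IHe i) ?mdeg_xy ?leq_ord.
  rewrite -aG // -aG' // /H /quot_coef => /subr_swap.
  by case: (_ == 0)%N; case: (_ == 0)%N; rewrite ?subrr.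
suff : H j p = 0 by move/eqP; rewrite subr_eq0 => /eqP.
have up q0 : forall k q1, (k + q0 <= d)%N -> (q0 + q1 + e)%N = d -> H k (xy q0 q1) = 0.
  elim: q0 => [|q0 IHq] k q1 kd qd.
    by have := @HE k 0%N q1.+1; rewrite quot_y quot_x; apply; lia.
  have := @HE k q0.+1 q1.+1; rewrite quot_y quot_x => -> //; try lia.
  by apply: IHq; lia.
have down q1 : forall k q0, (q1 < k <= d.+1)%N -> (q0 + q1 + e)%N = d -> H k (xy q0 q1) = 0.
  elim: q1 => [|q1 IHq] [|k] q0 //= kd qd.
    by have := @HE k q0.+1 0%N; rewrite quot_y quot_x => <- //; lia.
  have := @HE k q0.+1 q1.+1; rewrite quot_y quot_x => <- //; try lia.
  by apply: IHq; lia.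
move: pd; rewrite mdeg2 (xy_eta p) !xy_x !xy_y => pd.
have [jx|jx] := leqP (j + p x) d; first exact: up.
by apply: down => //; lia.
Qed.

Local Notation O := (simplicial 2 d).
Local Notation B := (border O).
Local Notation KC K := {mpoly K[size O * size B]}.

Section Generic.
Variables (K : fieldType) (h : {rmorphism KC K -> R}).

(** The coefficients of [g_j = b_j - sum_s c(s, b_j) s], specialized along [h]. *)
Definition prebasis (j : nat) (p : mon) : R :=
  if (mdeg p <= d)%N then - h (var K O B p (border_term j)) else (p == border_term j)%:R.

Lemma mdeg_border_term j : (j <= d.+1)%N -> mdeg (border_term j) = d.+1.
Proof. by move=> jd; rewrite mdeg_xy subnK. Qed.

Lemma prebasis_monic : monic_border prebasis.
Proof.
move=> j k jd kd; rewrite /prebasis mdeg_border_term // ltnn; congr (nat_of_bool _)%:R.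
apply/eqP/eqP => [|->] // /(congr1 (fun m : mon => m y)).
by rewrite !xy_y.
Qed.

Local Notation c := (fun k s => h (var K O B s (border_term k))).

Lemma quot_prebasis r j p : (mdeg p <= d.+1)%N ->
  quot_coef r (prebasis j) p = - quot_coef r (c j) p.
Proof.
rewrite /quot_coef => pd; case: eqP => pr; first by rewrite oppr0.
have le : (U_(r) <= p)%MM by rewrite lep1mP; apply/eqP.
rewrite /prebasis ifT //.
by move: pd; rewrite -{1}(submK le) mdegD mdeg1 addn1.
Qed.

(** The commutator equations and the syzygies are the same equations: substituting the
    value of [a_jk], a difference of two coordinates of top degree, turns [sum_k a_jk g_k]
    into the two sums over terms of degree [d]. *)
Lemma syzygy_top_product j p : (j <= d)%N -> (mdeg p <= d)%N ->
  quot_coef y (prebasis j) p - quot_coef x (prebasis j.+1) p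
    - \sum_(k < d.+2) syz_coef prebasis j k * prebasis k p =
  top_product h x y p (top_term j) - top_product h y x p (top_term j).
Proof.
move=> jd pd.
have ttx i : (i <= d)%N -> (U_(x) + top_term i)%MM = border_term i.
  by move=> id; rewrite addx -subSn.
have tty i : (U_(y) + top_term i)%MM = border_term i.+1.
  by rewrite addy /border_term subSS.
have sum_top F : \sum_(u <- top_terms 2 d) F u = \sum_(i < d.+1) F (top_term i) :> R.
  by rewrite (perm_big _ top_terms_perm) big_map big_enum.
rewrite /top_product !sum_top ttx // tty /=.
under [X in _ = _ + X - _]eq_bigr => i _ do rewrite ttx -1?ltnS // mulrC.
under [X in _ = _ - (_ + X)]eq_bigr => i _ do rewrite tty mulrC.
have -> : \sum_(k < d.+2) syz_coef prebasis j k * prebasis k p =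
    \sum_(i < d.+1) c j (top_term i) * c i.+1 p -
    \sum_(i < d.+1) c j.+1 (top_term i) * c i p.
  rewrite (eq_bigr (fun k : 'I_d.+2 => quot_coef y (c j) (border_term k) * c k p
                                  - quot_coef x (c j.+1) (border_term k) * c k p)).
    rewrite sumrB big_ord_recl quot_y mul0r add0r; congr (_ - _).
      by apply: eq_bigr => i _; rewrite quot_y_border.
    rewrite big_ord_recr /= [border_term d.+1]/border_term subnn quot_x mul0r addr0.
    by apply: eq_bigr => i _; rewrite quot_x_border ?leq_ord.
  move=> k _; rewrite /syz_coef !quot_prebasis ?mdeg_border_term ?leq_ord //.
  rewrite /prebasis pd; move: (quot_coef y _ _) (quot_coef x _ _) (h _) => u v w.
  by ring.
rewrite !quot_prebasis ?(leq_trans pd) //.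
move: (quot_coef y _ _) (quot_coef x _ _) (\sum_(i < d.+1) _) (\sum_(i < d.+1) _) => u v w w'.
by ring.
Qed.

Lemma prebasis_syzygy :
  (forall f : KC K, in_border_ideal f -> h f = 0) ->
  syzygy (syz_coef prebasis) prebasis.
Proof.
move=> hI j p jd; rewrite leq_eqVlt => /orP[/eqP pd|pd].
  have [+ +] := border_termE pd; move: (p y) => k -> kd.
  rewrite (bigD1 (inord k)) //= inordK // prebasis_monic // eqxx mulr1.
  rewrite big1 ?addr0 // => i ik.
  rewrite prebasis_monic ?leq_ord //; case: eqP => [ki|_]; last by rewrite mulr0.
  by move: ik; rewrite -ki inord_val eqxx.
apply/eqP; rewrite -subr_eq0 syzygy_top_product // subr_eq0; apply/eqP.
by apply: top_product_sym => //; rewrite mdeg_xy subnK.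
Qed.

Lemma border_ideal_of_syzygy a : syzygy a prebasis ->
  forall f : KC K, in_border_ideal f -> h f = 0.
Proof.
move=> ah.
have main p t : (mdeg p <= d)%N -> mdeg t = d ->
    top_product h x y p t = top_product h y x p t.
  move=> pd td; have yd : (t y <= d)%N by rewrite -td mdeg2 leq_addl.
  have -> : t = top_term (t y) by rewrite /top_term -td mdeg2 addnK; exact: xy_eta.
  apply/eqP; rewrite -subr_eq0 -syzygy_top_product // subr_eq0 ah // 1?ltnW //.
  apply/eqP/eq_bigr => k _; rewrite -(syzygy_coef ah prebasis_monic) //.
  exact: leq_ord.
apply: commutators_eq0 => k l p t pd td; move: k l.
apply: ord2_ind; apply: ord2_ind; [exact: erefl | exact: main | | exact: erefl].
exact/esym/main.
Qed.
End Generic.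
End Syzygies.

(** Over given constants, a homomorphism out of the polynomial ring of the coordinates is
    determined by its matrix of syzygies: the injectivity half of the isomorphism. *)
Lemma eq_of_syzygy (R : comNzRingType) (K : fieldType)
    (h1 h2 : {rmorphism
      {mpoly K[size (simplicial 2 d) * size (border (simplicial 2 d))]} -> R}) a :
  (forall c, h1 c%:MP = h2 c%:MP) ->
  syzygy a (prebasis h1) -> syzygy a (prebasis h2) -> h1 =1 h2.
Proof.
move=> hC syz1 syz2; apply: (eq_rmorph_var (simplicial_uniq 2 d) (border_uniq 2 d)) => // s b.
rewrite mem_simplicial mem_border => sd /eqP/border_termE[+ +]; move: (b y) => k -> kd.
suff: prebasis h1 k s = prebasis h2 k s by rewrite /prebasis sd => /oppr_inj.
apply: (syzygy_unique syz1 syz2) => //; last exact: leqW.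
by move=> j p _ pd; rewrite /prebasis pd ltnn.
Qed.

Lemma prebasis_rmorph (R S : comNzRingType) (K : fieldType)
    (h : {rmorphism
      {mpoly K[size (simplicial 2 d) * size (border (simplicial 2 d))]} -> R})
    (u : {rmorphism R -> S}) j p : prebasis (u \o h) j p = u (prebasis h j p).
Proof. by rewrite /prebasis; case: ifP => _; rewrite ?rmorphN ?rmorph_nat. Qed.

Lemma syz_coef_rmorph (R S : comNzRingType) (u : {rmorphism R -> S}) G j k :
  syz_coef (fun j p => u (G j p)) j k = u (syz_coef G j k).
Proof.
rewrite /syz_coef rmorphB /quot_coef.
by congr (_ - _); case: ifP; rewrite ?rmorph0.
Qed.

Lemma syzygy_rmorph (R S : comNzRingType) (u : {rmorphism R -> S}) a G :
  syzygy a G -> syzygy (fun j k => u (a j k)) (fun j p => u (G j p)).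
Proof.
move=> aG j p jd pd; transitivity (u (quot_coef y (G j) p - quot_coef x (G j.+1) p)).
  rewrite rmorphB /quot_coef.
  by congr (_ - _); case: ifP; rewrite ?rmorph0.
by rewrite aG // rmorph_sum; apply: eq_bigr => i _; rewrite rmorphM.
Qed.

End TwoVariables.

(** * The Hilbert-Burch matrix *)

Section Minors.
Variables (R : comNzRingType) (m : nat) (M : 'M[R]_(m, m.+1)).

(** The signs are normalized so that the last minor is the plain determinant. *)
Definition minor (k : 'I_m.+1) : R := (-1) ^+ (k + m) * \det (col' k M).

(** Laplace expansion along the first row of the square matrix obtained by repeating
    row [j] on top of [M]. *)
Lemma sum_minors (j : 'I_m) : \sum_k M j k * minor k = 0.
Proof.
pose N : 'M[R]_m.+1 := \matrix_(i, k) oapp (M^~ k) (M j k) (unlift ord0 i).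
have N0 k : N ord0 k = M j k by rewrite mxE unlift_none.
have NS i k : N (lift ord0 i) k = M i k by rewrite mxE liftK.
have detN : \det N = 0.
  by apply: (@determinant_alternate _ _ _ ord0 (lift ord0 j)) => // k; rewrite N0 NS.
rewrite (expand_det_row _ ord0) in detN.
transitivity ((-1) ^+ m * \sum_k N ord0 k * cofactor N ord0 k); last by rewrite detN mulr0.
rewrite mulr_sumr; apply: eq_bigr => k _.
have -> : cofactor N ord0 k = (-1) ^+ k * \det (col' k M).
  rewrite /cofactor add0n; congr (_ * \det _).
  by apply/matrixP => i i'; rewrite !mxE liftK.
rewrite N0 /minor exprD.
by move: ((-1) ^+ k) ((-1) ^+ m) (\det _) (M j k) => u v w z; ring.
Qed.
End Minors.

Section DetDegree.
Variables (R : idomainType) (n : nat).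
Implicit Types p q : {mpoly R[n]}.

Lemma msizeM_bound p q a b :
  (msize p <= a.+1 -> msize q <= b.+1 -> msize (p * q) <= (a + b).+1)%N.
Proof.
have [->|p0] := eqVneq p 0; first by rewrite mul0r msize0.
have [->|q0] := eqVneq q 0; first by rewrite mulr0 msize0.
have := p0; rewrite -msize_poly_eq0; have := q0; rewrite -msize_poly_eq0.
by rewrite msizeM //; move: (msize p) (msize q) => [|x] [|y] //; lia.
Qed.

Lemma msizeB_le p q e : (msize p <= e -> msize q <= e -> msize (p - q) <= e)%N.
Proof.
move=> pe qe; apply: leq_trans (msizeD_le _ _) _.
by rewrite geq_max pe msizeN.
Qed.

Lemma msizeD_bound p q e : (msize p <= e -> msize q <= e -> msize (p + q) <= e)%N.
Proof.
by move=> pe qe; apply: leq_trans (msizeD_le _ _) _; rewrite geq_max pe.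
Qed.

Lemma msizeM_linear p q e : (msize p <= e -> msize q <= 2 -> msize (p * q) <= e.+1)%N.
Proof.
case: e => [|e] pe q2.
  by move: pe; rewrite leqn0 msize_poly_eq0 => /eqP ->; rewrite mul0r msize0.
by rewrite -addn1; exact: msizeM_bound.
Qed.

Lemma msize_prod_bound m (F : 'I_m -> {mpoly R[n]}) :
  (forall i, msize (F i) <= 2)%N -> (msize (\prod_i F i) <= m.+1)%N.
Proof.
elim: m F => [|m IHm] F F2; first by rewrite big_ord0 msize1.
by rewrite big_ord_recr /=; apply: msizeM_linear => //; exact: IHm.
Qed.

(** Telescoping: replacing one linear factor at a time changes the product in lower
    degree only. *)
Lemma msize_prodB m (F G : 'I_m -> {mpoly R[n]}) :
  (forall i, msize (F i) <= 2)%N -> (forall i, msize (G i) <= 2)%N ->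
  (forall i, msize (F i - G i) <= 1)%N ->
  (msize (\prod_i F i - \prod_i G i) <= m)%N.
Proof.
elim: m F G => [|m IHm] F G F2 G2 FG; first by rewrite !big_ord0 subrr msize0.
rewrite !big_ord_recr /=; set f := F _; set g := G _.
set P := \prod_i _; set Q := \prod_i _.
have -> : P * f - Q * g = (P - Q) * f + Q * (f - g) by ring.
have PQ : (msize (P - Q) <= m)%N by apply: IHm.
apply: msizeD_bound; last first.
  have := @msizeM_bound Q (f - g) m 0; rewrite addn0; apply; last exact: FG.
  exact: msize_prod_bound.
exact: msizeM_linear PQ (F2 _).
Qed.

Lemma msize_detB m (P Q : 'M[{mpoly R[n]}]_m) :
  (forall i j, msize (P i j) <= 2)%N -> (forall i j, msize (Q i j) <= 2)%N ->
  (forall i j, msize (P i j - Q i j) <= 1)%N ->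
  (msize (\det P - \det Q) <= m)%N.
Proof.
move=> P2 Q2 PQ; rewrite /determinant -sumrB.
elim/big_ind: _ => [|p q|s _]; rewrite ?msize0 //; first exact: msizeD_bound.
rewrite -mulrBr mulr_sign; case: ifP => _; rewrite ?msizeN; exact: msize_prodB.
Qed.

End DetDegree.

Section Existence.
Variables (R : idomainType) (d : nat).
Local Notation mon := 'X_{1..2}.
Local Notation x := (@ord0 1).
Local Notation y := (@ord_max 1).
Local Notation bt := (border_term d).
Local Notation poly := {mpoly R[2]}.
Variable a : nat -> nat -> R.

(** The syzygies of the border terms themselves, which is the case [a = 0]. *)
Definition linear_part : 'M[poly]_(d.+1, d.+2) :=
  \matrix_(j, k) ('X_y *+ (j == k :> nat) - 'X_x *+ (j.+1 == k)).
Definition hilbert_burch : 'M[poly]_(d.+1, d.+2) :=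
  \matrix_(j, k) (linear_part j k - (a j k)%:MP).

Lemma hilbert_burchE j k : hilbert_burch j k = linear_part j k - (a j k)%:MP.
Proof. by rewrite mxE. Qed.

Lemma sum_linear (F : nat -> poly) (j : 'I_d.+1) :
  \sum_k linear_part j k * F k = 'X_y * F j - 'X_x * F j.+1.
Proof.
under eq_bigr => k _ do rewrite mxE mulrBl.
rewrite sumrB; congr (_ - _).
  rewrite (bigD1 (widen_ord (leqnSn _) j)) //= eqxx mulr1n big1 ?addr0 // => k kj.
  by case: eqP => [e|_]; rewrite ?mulr0n ?mul0r //; case/eqP: kj; apply: val_inj.
rewrite (bigD1 (lift ord0 j)) //= eqxx mulr1n big1 ?addr0 // => k kj.
by case: eqP => [e|_]; rewrite ?mulr0n ?mul0r //; case/eqP: kj; apply: val_inj.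
Qed.

Definition minor_at (M : 'M[poly]_(d.+1, d.+2)) (k : nat) : poly := minor M (inord k).

(** The last minor is the determinant of a triangular matrix with diagonal [y]; the
    others follow from it by the relations [y m_j = x m_(j+1)], cancelling [y]. *)
Lemma linear_minor k : (k <= d.+1)%N -> minor_at linear_part k = 'X_[bt k].
Proof.
suff H i : (i <= d.+1)%N -> minor_at linear_part (d.+1 - i) = 'X_[bt (d.+1 - i)].
  by move=> kd; have := H _ (leq_subr k d.+1); rewrite subKn.
elim: i => [|i IHi] id.
  rewrite subn0 /minor_at /minor inordK // -signr_odd addnn odd_double mul1r.
  have lift_last (i : 'I_d.+1) : lift (inord d.+1 : 'I_d.+2) i = i :> nat.
    by rewrite /= /bump inordK // leqNgt ltn_ord.
  rewrite -det_tr det_trig; last first.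
    apply/is_trig_mxP => i j ij; rewrite !mxE lift_last.
    by rewrite !gtn_eqF ?mulr0n ?subr0 // ltnW.
  rewrite (eq_bigr (fun=> 'X_y)) => [|j _]; last first.
    by rewrite !mxE lift_last eqxx gtn_eqF // mulr0n subr0.
  by rewrite prodr_const card_ord /border_term subnn /xy mulm0n add0m mpolyXn.
have k0 : (0 < d.+1 - i)%N by rewrite subn_gt0.
rewrite subnS; case: (d.+1 - i)%N k0 (leq_subr i d.+1) (IHi (ltnW id)) => // c _ cd IHc /=.
have := sum_linear (minor_at linear_part) (Ordinal cd).
rewrite (eq_bigr (fun j => linear_part (Ordinal cd) j * minor linear_part j)); last first.
  by move=> j _; rewrite /minor_at inord_val.
rewrite sum_minors /= IHc => /esym/eqP.
rewrite subr_eq0 -mpolyXD => /eqP e.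
have X0 : 'X_y != 0 :> poly by rewrite -msize_poly_eq0 msizeX.
apply: (mulfI X0); rewrite e -mpolyXD; congr 'X_[_].
by rewrite addx addy subSS -subSn.
Qed.

(** The matrix differs from its linear part by constants, so its maximal minors have the
    same leading forms. *)
Lemma hilbert_burch_minor k : (k <= d.+1)%N ->
  (msize (minor_at hilbert_burch k - 'X_[bt k]) <= d.+1)%N.
Proof.
move=> kd; rewrite -linear_minor // /minor_at /minor -mulrBr -signr_odd mulr_sign.
have X2 r b : (msize ('X_r *+ (b : bool) : poly) <= 2)%N.
  by case: b; rewrite ?mulr1n ?mulr0n ?msize0 // msizeX mdeg1.
have L2 i j : (msize (linear_part i j) <= 2)%N by rewrite mxE msizeB_le.
have C1 c : (msize (c%:MP : poly) <= 1)%N by rewrite msizeC leq_b1.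
suff: (msize (\det (col' (inord k : 'I_d.+2) hilbert_burch) -
                \det (col' (inord k : 'I_d.+2) linear_part)) <= d.+1)%N.
  by case: (odd _); rewrite ?msizeN.
apply: msize_detB => i j; rewrite !mxE.
- by apply: msizeB_le; [exact: msizeB_le | exact: leqW].
- by apply: msizeB_le.
- by rewrite addrAC subrr add0r msizeN.
Qed.

Lemma mcoeffXU_mul r (p : poly) m : ('X_r * p)@_m = quot_coef r (fun k => p@_k) m.
Proof.
rewrite mulrC /quot_coef; case: eqP => [mr|/eqP mr].
  apply: memN_msupp_eq0; rewrite (perm_mem (msuppMX _ _)).
  by apply/mapP => -[k _ mE]; move: mr; rewrite mE mnmDE mnm1E eqxx.
have le : (U_(r) <= m)%MM by rewrite lep1mP.
by rewrite -{1}(submK le) addmC mcoeffMX.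
Qed.

Lemma hilbert_burch_relation j : (j <= d)%N ->
  'X_y * minor_at hilbert_burch j - 'X_x * minor_at hilbert_burch j.+1 =
  \sum_(k < d.+2) (a j k)%:MP * minor_at hilbert_burch k.
Proof.
move=> jd; pose j0 : 'I_d.+1 := Ordinal (jd : (j < d.+1)%N).
rewrite -(sum_linear (minor_at hilbert_burch) j0).
apply/eqP; rewrite -subr_eq0 -sumrB -[X in _ == X](sum_minors hilbert_burch j0).
apply/eqP/eq_bigr => k _.
by rewrite hilbert_burchE mulrBl /minor_at inord_val.
Qed.

Lemma exists_syzygy : exists G : nat -> mon -> R, syzygy d a G /\
  forall j p, (j <= d.+1)%N -> mdeg p = d.+1 -> G j p = (p == bt j)%:R.
Proof.
exists (fun j p => (minor_at hilbert_burch j)@_p); split=> [j p jd pd|j p jd pd].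
  rewrite -!mcoeffXU_mul -mcoeffB hilbert_burch_relation // raddf_sum.
  by apply: eq_bigr => k _; rewrite /= mcoeffCM.
have /memN_msupp_eq0 : p \notin msupp (minor_at hilbert_burch j - 'X_[bt j]).
  by apply: msize_mdeg_ge; rewrite pd hilbert_burch_minor.
by rewrite mcoeffB mcoeffX [bt j == p]eq_sym => /eqP; rewrite subr_eq0 => /eqP.
Qed.

End Existence.

(** * The border basis scheme of the plane *)

Section Descent.
Variables (K : fieldType) (n d : nat).
Local Notation O := (simplicial n d).
Local Notation B := (border O).
Local Notation KC := {mpoly K[size O * size B]}.
Local Notation A := (coord_ring K n d).
Local Notation pr := (@proj K n d).

Lemma proj_ideal f : in_border_ideal f -> pr f = 0.
Proof.
move=> If; apply/eqP; rewrite -(rmorph0 pr) -Quotient.idealrBE subr0.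
exact/border_idealP.
Qed.

Section Map.
Variables (S : comAlgType K) (h : {rmorphism KC -> S}).
Hypotheses (hC : forall c, h c%:MP = c%:A) (hI : forall f, in_border_ideal f -> h f = 0).

Definition descent (u : A) : S := h (repr u).

Lemma descentE f : descent (pr f) = h f.
Proof.
have : pr (repr (pr f)) = pr f by exact: reprK.
move=> /eqP; rewrite -Quotient.idealrBE => /border_idealP/hI.
by rewrite rmorphB => /eqP; rewrite subr_eq0 => /eqP.
Qed.

Lemma descent_zmod : zmod_morphism descent.
Proof.
by move=> u v; rewrite -(proj_repr u) -(proj_repr v) -rmorphB !descentE rmorphB.
Qed.
Lemma descent_monoid : monoid_morphism descent.
Proof.
split; first by rewrite -(rmorph1 pr) descentE rmorph1.
by move=> u v; rewrite -(proj_repr u) -(proj_repr v) -rmorphM !descentE rmorphM.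
Qed.
Lemma descent_scale : scalable descent.
Proof.
move=> c u; rewrite -(proj_repr u) -[c *: _]/(pr c%:MP * _) -rmorphM !descentE.
by rewrite rmorphM /= hC mulr_algl.
Qed.

HB.instance Definition _ := GRing.isZmodMorphism.Build A S descent descent_zmod.
HB.instance Definition _ := GRing.isMonoidMorphism.Build A S descent descent_monoid.
HB.instance Definition _ := GRing.isScalable.Build K A S *:%R descent descent_scale.

Lemma exists_descent : exists phi : {lrmorphism A -> S}, forall f, phi (pr f) = h f.
Proof. by exists descent; exact: descentE. Qed.

End Map.
End Descent.

Section Plane.
Variables (K : fieldType) (d : nat).
Local Notation O := (simplicial 2 d).
Local Notation B := (border O).
Local Notation KC := {mpoly K[size O * size B]}.
Local Notation A := (coord_ring K 2 d).
Local Notation Ka := {mpoly K[d.+1 * d.+2]}.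
Local Notation pr := (@proj K 2 d).
Local Notation mon := 'X_{1..2}.
Local Notation cvar := (var K O B).

Definition syz_var (j k : nat) : Ka :=
  'X_(mxvec_index (inord j : 'I_d.+1) (inord k : 'I_d.+2)).

(** The universal case of the existence half: a family of border bases over the polynomial
    ring on the entries of the matrix of syzygies. *)
Lemma exists_generic_prebasis : exists h : {rmorphism KC -> Ka},
  (forall c, h c%:MP = c%:MP) /\ syzygy d syz_var (prebasis h).
Proof.
have [G [aG topG]] := exists_syzygy d syz_var.
pose g (s b : mon) := - G (b ord_max) s.
have [h [hC h_var]] : exists h : {rmorphism KC -> Ka}, (forall c, h c%:MP = c%:MP) /\
    forall s b, (mdeg s <= d)%N -> mdeg b = d.+1 -> h (cvar s b) = g s b.
  exists (mmap (@mpolyC _ K) (point g)); split=> [c|s b sd bd]; first by rewrite /= mmapC.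
  rewrite /= mmap_var ?simplicial_uniq ?border_uniq ?mem_simplicial //.
  by rewrite mem_border bd.
exists h; split=> // j p jd pd.
have prebasisE i q : (i <= d.+1)%N -> (mdeg q <= d.+1)%N -> prebasis h i q = G i q.
  move=> id qd; rewrite /prebasis; case: ifP => qd'.
    by rewrite h_var ?mdeg_border_term // /g xy_y opprK.
  rewrite topG //; apply/eqP; rewrite eqn_leq qd /=.
  by rewrite ltnNge qd'.
have quotE r i q : (i <= d.+1)%N -> (mdeg q <= d.+1)%N ->
    quot_coef r (prebasis h i) q = quot_coef r (G i) q.
  move=> id qd; rewrite /quot_coef; case: ifP => // _; apply: prebasisE => //.
  exact: leq_trans (mdegB _ _) qd.
rewrite !quotE ?aG ?(leqW jd) //; apply: eq_bigr => k _.
by rewrite prebasisE ?leq_ord.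
Qed.

(** The two maps are [c |-> coefficients of the minors] and [a_jk |-> coefficient of b_k in
    y g_j - x g_(j+1)]. *)
Lemma coord_ring_plane : exists phi : {lrmorphism A -> Ka}, bijective phi.
Proof.
have [h [hC hsyz]] := exists_generic_prebasis.
have hI := border_ideal_of_syzygy hsyz.
have hA c : h c%:MP = c%:A by rewrite hC alg_mpolyC.
have [phi phiE] := exists_descent hA hI.
exists phi.
pose G : nat -> mon -> A := prebasis pr.
have Gsyz : syzygy d (syz_coef d G) G := prebasis_syzygy (@proj_ideal K 2 d).
have [psi [psiC psiX]] : exists psi : {rmorphism Ka -> A},
    (forall c, psi c%:MP = pr c%:MP) /\
    forall j k, (j <= d)%N -> (k <= d.+1)%N -> psi (syz_var j k) = syz_coef d G j k.
  exists (mmap (pr \o @mpolyC _ K)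
    (fun v => mxvec (\matrix_(j < d.+1, k < d.+2) syz_coef d G j k) 0 v)).
  split=> [c|j k jd kd]; first by rewrite /= mmapC.
  by rewrite /= mmapX mmap1U mxvecE mxE !inordK.
(* Both sides have the same syzygies, so uniqueness applies over the coordinate ring. *)
have psi_h : psi \o h =1 pr.
  apply: (eq_of_syzygy (a := syz_coef d G)) Gsyz => [c|]; first by rewrite /= hC psiC.
  apply: eq_syzygy psiX _; have := syzygy_rmorph psi hsyz.
  rewrite (_ : (fun j p => _) = prebasis (psi \o h)) //.
  by apply/funext => j; apply/funext => p; rewrite -prebasis_rmorph.
exists psi => [u|]; first by rewrite -(proj_repr u) phiE -psi_h.
apply: (@eq_rmorph_mpoly _ _ _ (phi \o psi) idfun) => [c|v] /=.
  by rewrite psiC phiE hC.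
case/mxvec_indexP: v => j k.
have -> : 'X_(mxvec_index j k) = syz_var j k by rewrite /syz_var !inord_val.
have jd : (j <= d)%N := leq_ord j; have kd : (k <= d.+1)%N := leq_ord k.
rewrite psiX // (syzygy_coef hsyz (prebasis_monic h) jd kd).
apply: etrans (esym (syz_coef_rmorph d phi G j k)) _.
congr (syz_coef d _ j k); apply/funext => i; apply/funext => p.
by rewrite -prebasis_rmorph; rewrite /prebasis; case: ifP => //= _; rewrite phiE.
Qed.

End Plane.

(** * Length of chains of primes *)

Section Combinations.
Variable R : comNzRingType.

Fixpoint monomial (f : nat -> R) (e : seq nat) : R :=
  if e is a :: e' then f 0%N ^+ a * monomial (f \o succn) e' else 1.

(** Polynomial expressions in the values of [f], given by a list of exponent vectors; lists
    make the induction on the number of indeterminates structural. *)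
Definition combination (f : nat -> R) (c : seq nat -> R) (E : seq (seq nat)) :=
  \sum_(e <- E) c e * monomial f e.

(** Factor out the least power of the first element: what remains is a polynomial in the
    other elements, whose coefficients are some of the given ones, plus a multiple of the
    first element. *)
Lemma combination_split (f : nat -> R) c (E : seq (seq nat)) m :
  uniq E -> E != [::] -> all (fun e => size e == m.+1) E ->
  exists a E' rest,
    [/\ uniq E', E' != [::], all (fun e => size e == m) E',
        all (fun e => a :: e \in E) E'
      & combination f c E = f 0%N ^+ a *
          (combination (f \o succn) (fun e => c (a :: e)) E' + f 0%N * rest)].
Proof.
move=> uE nzE szE.
have headE e : e \in E -> e = head 0%N e :: behead e.
  by move=> /(allP szE); case: e.
have [e0 e0E] : exists e, e \in E.
  by case: (E) nzE => // e E1 _; exists e; rewrite mem_head.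
have ex_a : exists a, has (fun e => head 0%N e == a) E.
  by exists (head 0%N e0); apply/hasP; exists e0.
case: (ex_minnP ex_a) => a /hasP[e1 e1E /eqP e1a] amin.
have leE e : e \in E -> (a <= head 0%N e)%N.
  by move=> eE; apply: amin; apply/hasP; exists e.
pose Ea := [seq e <- E | head 0%N e == a].
have EaE e : e \in Ea -> e = a :: behead e /\ e \in E.
  by rewrite mem_filter => /andP[/eqP <- eE]; rewrite -headE.
exists a, [seq behead e | e <- Ea],
  (\sum_(e <- E | head 0%N e != a)
     c e * (f 0%N ^+ (head 0%N e - a.+1) * monomial (f \o succn) (behead e))).
split.
- rewrite map_inj_in_uniq ?filter_uniq // => x y /EaE[-> _] /EaE[-> _] /=.
  by move=> ->.
- rewrite -size_eq0 size_map size_eq0 -has_filter.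
  by apply/hasP; exists e1; rewrite ?e1a.
- apply/allP => _ /mapP[e /EaE[eE] /(allP szE) + ->].
  by rewrite {1}eE /=.
- by apply/allP => _ /mapP[e /EaE[eE +] ->]; rewrite {1}eE.
rewrite /combination (bigID (fun e => head 0%N e == a)) /= mulrDr.
congr (_ + _).
  rewrite big_map mulr_sumr -big_filter big_seq [RHS]big_seq.
  apply: eq_bigr => e /EaE[eE _].
  by rewrite -eE {2}eE /= mulrCA.
rewrite !mulr_sumr big_seq_cond [RHS]big_seq_cond; apply: eq_bigr => e.
move=> /andP[eE ea]; rewrite {2}(headE _ eE) /=.
rewrite [f 0%N * (c e * _)]mulrCA [RHS]mulrCA; congr (_ * _).
rewrite !mulrA -exprSr -exprD; congr (_ ^+ _ * _).
by have := leE _ eE; move: ea; lia.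
Qed.

(** The elementary characterization of Krull dimension by Coquand and Lombardi.  If the
    combination were in [P 0], split off the power of [f 0], which is not in the prime
    [P 0]; the cofactor lies in [P 0], hence in [P 1], and so does [f 0], so the polynomial
    in the remaining elements lies in [P 1].  Iterating, a single coefficient, the one of
    the lexicographically smallest exponent, would lie in the last prime. *)
Lemma combination_notin (m : nat) (f : nat -> R) (P : nat -> prime_idealr R) c
    (E : seq (seq nat)) :
  (forall i, (i < m)%N -> {subset P i <= P i.+1}) ->
  (forall i, (i < m)%N -> f i \in P i.+1 /\ f i \notin P i) ->
  uniq E -> E != [::] -> all (fun e => size e == m) E ->
  (forall e, e \in E -> c e \notin P m) ->
  combination f c E \notin P 0%N.
Proof.
elim: m => [|m IHm] in f P c E * => chain fP uE nzE szE cP.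
  have E1 : E = [:: [::]].
    case: E uE nzE szE {cP} => // e [|e' E] /=.
      by move=> _ _ /andP[/nilP -> _].
    move=> uE1 _ /and3P[/eqP/size0nil e0 /eqP/size0nil e0_ _]; move: uE1.
    by rewrite e0 e0_ inE eqxx.
  by rewrite /combination E1 big_seq1 /= mulr1 cP // E1 mem_head.
have [a [E' [rest [uE' nzE' szE' EE' ->]]]] := combination_split f c uE nzE szE.
have [f0in f0nin] := fP 0%N isT.
rewrite prime_idealrM negb_or; apply/andP; split.
  elim: a {EE'} => [|a IHa]; first by rewrite expr0 idealr1.
  by rewrite exprS prime_idealrM negb_or f0nin.
apply/negP => /(chain 0%N isT).
rewrite rpredDr; last by rewrite mulrC idealMr.
apply/negP; apply: (IHm (f \o succn) (fun i => P i.+1)) => // [i im|i im|e eE'].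
- exact: chain.
- exact: fP.
- by apply: cP; exact: (allP EE').
Qed.

End Combinations.

Lemma rmorph_combination (R S : comNzRingType) (h : {rmorphism R -> S}) f c E :
  h (combination f c E) = combination (h \o f) (h \o c) E.
Proof.
rewrite rmorph_sum; apply: eq_bigr => e _; rewrite rmorphM; congr (_ * _).
elim: e f => [|a e IHe] f /=; first by rewrite rmorph1.
by rewrite rmorphM rmorphXn IHe.
Qed.

Section AlgebraicDependence.
Variables (K : fieldType) (N : nat).

Lemma msize_monomial (f : nat -> {mpoly K[N]}) D e :
  (forall i, (i < size e)%N -> (msize (f i) <= D.+1)%N) ->
  (msize (monomial f e) <= (sumn e * D).+1)%N.
Proof.
elim: e f => [|a e IHe] f fD /=; first by rewrite msize1.
rewrite mulnDl; apply: msizeM_bound; last by apply: IHe => i ie; exact: fD.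
elim: a {fD IHe} (fD 0%N isT) => [|a IHa] f0D; first by rewrite expr0 msize1.
by rewrite exprS mulSn; apply: msizeM_bound => //; exact: IHa.
Qed.

Lemma card_bmnm_le L : (#|{: 'X_{1..N < L}}| <= L ^ N)%N.
Proof.
case: L => [|L].
  by rewrite eq_card0 // => -[m].
pose code (m : 'X_{1..N < L.+1}) : {ffun 'I_N -> 'I_L.+1} := [ffun i => inord (m i)].
rewrite -[X in (_ <= X ^ _)%N]card_ord -[X in (_ <= _ ^ X)%N]card_ord -card_ffun.
apply: (@leq_card _ _ code) => m1 m2 /ffunP e; apply/val_inj/mnmP => i.
have lt (m : 'X_{1..N < L.+1}) : (m i < L.+1)%N.
  apply: leq_ltn_trans (bmdeg m); rewrite mdegE (bigD1 i) //=.
  exact: leq_addr.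
by have := congr1 val (e i); rewrite !ffunE /= !inordK.
Qed.

(** Any [N + 1] polynomials in [N] variables are algebraically dependent, by counting.  If
    they have degree at most [D], the [B ^ (N + 1)] monomials in them with exponents less
    than [B] lie in the space of polynomials of degree less than [L = (N + 1) B D + 1],
    whose dimension is at most [L ^ N]; this is smaller as soon as
    [B > ((N + 1) D + 1) ^ N]. *)
Lemma exists_combination_eq0 (f : nat -> {mpoly K[N]}) :
  exists E (c : seq nat -> K),
    [/\ uniq E, E != [::], all (fun e => size e == N.+1) E,
        forall e, e \in E -> c e != 0
      & combination f (fun e => (c e)%:MP) E = 0].
Proof.
pose D := (\max_(i < N.+1) msize (f i))%N.
pose B := ((N.+1 * D + 1) ^ N).+1.
pose L := (N.+1 * B * D).+1.
pose X := N.+1.-tuple 'I_B.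
pose ex (x : X) : seq nat := map val x.
have ex_inj : injective ex.
  by move=> x y /(inj_map val_inj) xy; apply: val_inj.
have ex_size x : size (ex x) = N.+1 by rewrite size_map size_tuple.
pose A : 'M[K]_(#|{: X}|, #|{: 'X_{1..N < L}}|) :=
  \matrix_(i, j) (monomial f (ex (enum_val i)))@_(enum_val j : 'X_{1..N < L}).
have ker : kermx A != 0.
  rewrite kermx_eq0 /row_free neq_ltn; apply/orP; left.
  apply: leq_ltn_trans (rank_leq_col A) _.
  apply: leq_ltn_trans (card_bmnm_le L) _.
  rewrite card_tuple card_ord expnS.
  apply: (@leq_ltn_trans ((B * (N.+1 * D + 1)) ^ N)).
    have lexp x y e : (x <= y -> x ^ e <= y ^ e)%N.
      by case: e => // e; rewrite leq_exp2r.
    by apply: lexp; rewrite /L mulnDr muln1 mulnAC mulnC -addn1 leq_add2l.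
  by rewrite expnMn mulnC ltn_pmul2r ?expn_gt0 // /B.
have /rowV0Pn[u /sub_kermxP uA u0] := ker.
have [i0 ui0] : exists i, u 0 i != 0.
  apply/existsP; rewrite -negb_forall; apply: contraNN u0 => /forallP u0.
  by apply/eqP/rowP => i; rewrite mxE; apply/eqP.
pose U := [seq i <- enum 'I_#|{: X}| | u 0 i != 0].
pose E := [seq ex (enum_val i) | i <- U].
pose c e := \sum_(i <- U | ex (enum_val i) == e) u 0 i.
have ex_val_inj : injective (fun i : 'I_#|{: X}| => ex (enum_val i)).
  by move=> i j /ex_inj/enum_val_inj.
have uU : uniq U by rewrite filter_uniq ?enum_uniq.
have cE i : i \in U -> c (ex (enum_val i)) = u 0 i.
  move=> iU; rewrite /c big_mkcond (bigD1_seq i) //= eqxx big1 ?addr0 // => j.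
  by case: (_ =P ex (enum_val i)) => // /ex_val_inj ->; rewrite eqxx.
exists E, c; split.
- by rewrite map_inj_uniq.
- have i0U : i0 \in U by rewrite mem_filter ui0 mem_enum.
  by rewrite /E; case: (U) i0U.
- by apply/allP => _ /mapP[i _ ->]; rewrite ex_size.
- move=> _ /mapP[i iU ->]; rewrite cE //.
  by move: iU; rewrite mem_filter => /andP[].
apply/mpolyP => k; rewrite mcoeff0 /combination big_map big_seq.
under eq_bigr => i iU do rewrite cE // mul_mpolyC.
rewrite -big_seq raddf_sum /=.
under eq_bigr => i _ do rewrite mcoeffZ.
rewrite big_filter big_enum_cond /= big_mkcond /=.
rewrite (eq_bigr (fun i => u 0 i * (monomial f (ex (enum_val i)))@_k)); last first.
  by move=> i _; case: eqP => //= ->; rewrite mul0r.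
have [kL|kL] := ltnP (mdeg k) L; last first.
  apply: big1 => i _; rewrite (memN_msupp_eq0 (msize_mdeg_ge _)) ?mulr0 //.
  apply: leq_trans kL; apply: (@leq_trans (sumn (ex (enum_val i)) * D).+1).
    apply: msize_monomial => j; rewrite ex_size => jN.
    exact: leqW (leq_bigmax (Ordinal jN)).
  rewrite ltnS leq_mul2r; apply/orP; right.
  rewrite -{2}(ex_size (enum_val i)) /ex.
  elim: (val (enum_val i)) => //= a s IHs.
  by have := ltn_ord a; lia.
move/rowP/(_ (enum_rank (BMultinom kL))): uA; rewrite !mxE => uA.
by rewrite -[RHS]uA; apply: eq_bigr => i _; rewrite mxE enum_rankK.
Qed.

End AlgebraicDependence.

(** Apply algebraic dependence to [F] followed by elements witnessing the strictness of the
    chain.  A power of [F] cancels in the polynomial ring, and what remains is, modulo [F],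
    a polynomial in the witnesses that [h] maps to 0, an element of the first prime. *)
Lemma no_long_chain (K : fieldType) (N : nat) (R : comNzRingType)
    (h : {rmorphism {mpoly K[N]} -> R}) (F : {mpoly K[N]})
    (P : nat -> prime_idealr R) (f : nat -> {mpoly K[N]}) :
  F != 0 -> h F = 0 ->
  (forall i, (i < N)%N -> {subset P i <= P i.+1}) ->
  (forall i, (i < N)%N -> h (f i) \in P i.+1 /\ h (f i) \notin P i) ->
  False.
Proof.
move=> F0 hF chain fP.
pose fs i := if i is i'.+1 then f i' else F.
have [E [c [uE nzE szE cE]]] := exists_combination_eq0 fs.
have [a [E' [rest [uE' nzE' szE' EE' ->]]]] :=
  combination_split fs (fun e => (c e)%:MP) uE nzE szE.
move/eqP; rewrite mulf_eq0 expf_eq0 (negbTE F0) andbF /= => /eqP/(congr1 h).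
rewrite rmorph0 rmorphD rmorphM /= hF mul0r addr0 rmorph_combination => eq0.
suff: combination (h \o (fs \o succn)) (h \o (fun e => (c (a :: e))%:MP)) E' \notin P 0%N.
  by rewrite eq0 idealr0.
apply: combination_notin chain fP uE' nzE' szE' _ => e eE' /=.
have ce : c (a :: e) != 0 by apply: cE; exact: (allP EE').
apply/negP => cP; have : 1 \in P N by
  rewrite -(rmorph1 h) -mpolyC1 -(mulVf ce) mpolyCM rmorphM idealMr.
by rewrite idealr1.
Qed.

(** * Localization and cotangent spaces *)

Local Notation frac := Defs.frac.

Section LocalizationMap.
Variables (A : comNzRingType) (P : prime_idealr A).
Local Notation L := (localization P).

Lemma frac_add (a b : A) (s t : denom P) :
  frac a s + frac b t = frac (a * sval t + b * sval s) (mul_denom s t).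
Proof. exact: loc_addE. Qed.

Lemma frac_mul (a b : A) (s t : denom P) :
  frac a s * frac b t = frac (a * b) (mul_denom s t).
Proof. exact: loc_mulE. Qed.

Definition to_loc (a : A) : L := frac a (one_denom P).

Lemma to_loc_is_zmod_morphism : zmod_morphism to_loc.
Proof.
move=> a b; rewrite /to_loc -[- frac b _]/(loc_opp _) loc_oppE frac_add.
by apply: frac_congr; rewrite /= !mulr1.
Qed.

Lemma to_loc_is_monoid_morphism : monoid_morphism to_loc.
Proof. by split=> // a b; rewrite /to_loc frac_mul; apply: frac_congr; rewrite /= !mulr1. Qed.

HB.instance Definition _ := GRing.isZmodMorphism.Build A L to_loc to_loc_is_zmod_morphism.
HB.instance Definition _ := GRing.isMonoidMorphism.Build A L to_loc to_loc_is_monoid_morphism.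

Lemma clear_denom (a : A) (s : denom P) : to_loc a = to_loc (sval s) * frac a s.
Proof. by rewrite /to_loc frac_mul; apply: frac_congr => /=; rewrite mul1r mulr1 mulrC. Qed.

Lemma to_loc_denomK (s : denom P) : frac 1 s * to_loc (sval s) = 1.
Proof. by rewrite mulrC -clear_denom rmorph1. Qed.

(** The fractions with numerator in [P]. *)
Definition loc_max : {pred L} := fun x => (repr x).1 \in P.

Lemma frac_in_max a (s : denom P) : (frac a s \in loc_max) = (a \in P).
Proof.
rewrite unfold_in; have [u /eqP hu] := repr_frac a s.
move: (repr (frac a s)) hu => [a' s'] /= hu.
have nu := valP u; have ns := valP s; have ns' := valP s'.
have /(congr1 (fun x => x \in P)) : sval u * (a' * sval s) = sval u * (a * sval s').
  by apply/eqP; rewrite -subr_eq0 -mulrBr.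
by rewrite !prime_idealrM (negbTE nu) (negbTE ns) (negbTE ns') /= !orbF.
Qed.

Lemma loc_max_closed : idealr_closed loc_max.
Proof.
split.
- by rewrite -(rmorph0 to_loc) frac_in_max idealr0.
- by rewrite -(rmorph1 to_loc) frac_in_max idealr1.
move=> x y z; rewrite -(fracE x) -(fracE y) -(fracE z) frac_mul frac_add.
rewrite !frac_in_max => yP zP; rewrite rpredD //.
  by rewrite mulrC idealMr // idealMr.
by rewrite mulrC idealMr.
Qed.
HB.instance Definition _ := isIdealr.Build L loc_max loc_max_closed.

Lemma loc_max_maximal : maximal_ideal (loc_max : idealr L).
Proof.
move=> J _ x xJ; rewrite -(fracE x) frac_in_max; apply/negPn/negP => xP.
pose u : denom P := exist _ (repr x).1 xP.
have : 1 \in J.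
  rewrite -(to_loc_denomK u) idealMr //=.
  by rewrite (clear_denom _ (repr x).2) fracE idealMr.
by rewrite idealr1.
Qed.

End LocalizationMap.

Section TangentBound.
Variables (R : comNzRingType) (K : fieldType) (m : idealr R) (N : nat).
Variables (ev : R -> K) (D : 'I_N -> R -> K) (y : 'I_N -> R).

(** [D w] is a derivation at the point [ev], known only on the maximal ideal.  It kills the
    square of the ideal, so its values on [e] generators of the cotangent space determine
    it: the coefficients of the [y v] in these generators form an [N x e] matrix, and its
    product with the [e x N] matrix of values is the identity. *)
Lemma cotangent_dim_ge e :
  (forall w, {in m &, {morph D w : a b / a + b}}) ->
  (forall w b, {in m, forall a, D w (b * a) = ev b * D w a}) ->
  {in m, forall a, ev a = 0} ->
  (forall w, y w \in m) ->
  (forall w v, D w (y v) = (w == v)%:R) ->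
  cotangent_dim m e -> (N <= e)%N.
Proof.
move=> DD DM ev0 ym Dy [x [xm xgen _]].
have D0 w : D w 0 = 0.
  have := DD w _ _ (idealr0 m) (idealr0 m); rewrite addr0 => /eqP.
  by rewrite -subr_eq0 opprD addrA subrr sub0r oppr_eq0 => /eqP.
have Dsum w k (F : 'I_k -> R) : (forall i, F i \in m) ->
    D w (\sum_i F i) = \sum_i D w (F i).
  move=> Fm; elim: k F Fm => [|k IHk] F Fm; first by rewrite !big_ord0 D0.
  rewrite !big_ord_recl DD ?IHk //; exact: rpred_sum.
have Dsq w z : ideal_square m z -> D w z = 0.
  move=> [k [u [v [uv ->]]]]; rewrite Dsum.
    by rewrite big1 // => i _; rewrite DM ?ev0 ?mul0r //; case: (uv i).
  by move=> i; rewrite idealMr //; case: (uv i).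
have /fin_all_exists[a aP] v : exists a, ideal_square m (y v - \sum_(i < e) a i * x i).
  exact: xgen.
pose M1 : 'M[K]_(N, e) := \matrix_(v, i) ev (a v i).
pose M2 : 'M[K]_(e, N) := \matrix_(i, w) D w (x i).
have M12 : M1 *m M2 = 1%:M.
  apply/matrixP => v w; rewrite !mxE eq_sym -Dy.
  have sm : \sum_(i < e) a v i * x i \in m by apply: rpred_sum => i _; exact: idealMr.
  rewrite -[y v](subrK (\sum_(i < e) a v i * x i)) DD ?rpredB // Dsq // add0r Dsum.
    by apply: eq_bigr => i _; rewrite !mxE DM.
  by move=> i; exact: idealMr.
by rewrite -[N](mxrank1 K) -M12 (leq_trans (mxrankM_maxl _ _)) ?rank_leq_col.
Qed.
End TangentBound.

(** * Generation by the coordinates of top degree, and a relation among them *)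

Section TopCoordinates.
Variables (K : fieldType) (n d : nat).
Local Notation O := (simplicial n d).
Local Notation B := (border O).
Local Notation T := (top_terms n d).
Local Notation KC := {mpoly K[size O * size B]}.
Local Notation KT := {mpoly K[size T * size B]}.
Local Notation mon := 'X_{1..n}.
Local Notation cvar := (var K O B).
Local Notation tvar := (var K T B).
Local Notation uO := (simplicial_uniq n d).
Local Notation uB := (border_uniq n d).

(** Any ring in which the equations hold, such as the coordinate ring. *)
Variables (A : comNzRingType) (pr : {rmorphism KC -> A}).
Hypothesis pr_ideal : forall f, in_border_ideal f -> pr f = 0.

Local Notation uT := (top_uniq n d).

Definition coord (s b : mon) : A := pr (cvar s b).

Lemma coord_sym k l p t : (mdeg p <= d)%N -> mdeg t = d ->
  top_product pr k l p t = top_product pr l k p t.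
Proof. exact: top_product_sym pr_ideal _ _ _ _. Qed.

(** A commutator equation, read as a rule that replaces [c(s, x_l t)] by
    [c(s x_k / x_l, x_k t)], or by 0 when [x_l] does not divide [s], up to products of
    coordinates [c(p, b)] with [deg p > deg s]. *)
Lemma coord_move k l s t : (mdeg s < d)%N -> mdeg t = d ->
  coord s (U_(l) + t)%MM =
  quot_coef l (coord^~ (U_(k) + t)%MM) (s + U_(k))%MM +
  \sum_(u <- T) (coord (s + U_(k))%MM (U_(l) + u)%MM * coord u (U_(k) + t)%MM -
                 coord (s + U_(k))%MM (U_(k) + u)%MM * coord u (U_(l) + t)%MM).
Proof.
move=> sd td; have pd : (mdeg (s + U_(k)) <= d)%N by rewrite mdegD mdeg1 addn1.
have := coord_sym k l pd td; rewrite /top_product [quot_coef k _ _]/quot_coef mnmDE mnm1E eqxx.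
rewrite addn1 /= addmK /coord => /(canRL (addrK _)) ->; rewrite -addrA; congr (_ + _).
by rewrite -sumrB.
Qed.

Lemma exists_of_top : exists h : {rmorphism KT -> A},
  (forall c, h c%:MP = pr c%:MP) /\
  (forall s b, mdeg s = d -> mdeg b = d.+1 -> h (tvar s b) = coord s b).
Proof.
exists (mmap (pr \o @mpolyC _ K) (point coord)); split=> [c|s b sd bd] /=.
  by rewrite mmapC.
rewrite mmap_var ?uT ?uB //; first by rewrite mem_top_terms sd.
by rewrite mem_border bd.
Qed.

Variable of_top : {rmorphism KT -> A}.
Hypothesis of_topC : forall c, of_top c%:MP = pr c%:MP.
Hypothesis of_top_var :
  forall s b, mdeg s = d -> mdeg b = d.+1 -> of_top (tvar s b) = coord s b.

Definition generated (x : A) := exists f, of_top f = x.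

Lemma generatedD x y : generated x -> generated y -> generated (x + y).
Proof. by move=> [f <-] [g <-]; exists (f + g); rewrite rmorphD. Qed.
Lemma generatedB x y : generated x -> generated y -> generated (x - y).
Proof. by move=> [f <-] [g <-]; exists (f - g); rewrite rmorphB. Qed.
Lemma generatedM x y : generated x -> generated y -> generated (x * y).
Proof. by move=> [f <-] [g <-]; exists (f * g); rewrite rmorphM. Qed.
Lemma generated0 : generated 0. Proof. by exists 0; rewrite rmorph0. Qed.
Lemma generated_sum (I : eqType) (r : seq I) (F : I -> A) :
  (forall i, i \in r -> generated (F i)) -> generated (\sum_(i <- r) F i).
Proof.
move=> genF; rewrite big_seq; elim/big_ind: _ => //; [exact: generated0|exact: generatedD].
Qed.

Hypothesis n2 : (1 < n)%N.

Lemma exists_other (l : 'I_n) : exists k : 'I_n, k != l.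
Proof.
have [->|l0] := eqVneq l (Ordinal n2); last by exists (Ordinal n2); rewrite eq_sym.
by exists (Ordinal (ltnW n2)).
Qed.

(** Induction on the codegree of [s].  As [deg s < deg b], some variable [x_l] has a smaller
    exponent in [s] than in [b]; moving [x_l] out of both repeatedly makes the exponent in
    [s] vanish, and then the coordinate is a sum of products of generated elements. *)
Lemma coord_generated e s b : (mdeg s + e)%N = d -> mdeg b = d.+1 -> generated (coord s b).
Proof.
elim: e s b => [|e IHe] s b.
  by rewrite addn0 => sd bd; exists (tvar s b); rewrite of_top_var.
move=> sd bd.
have [l slb] : exists l, (s l < b l)%N.
  apply/existsP; rewrite -[[exists _, _]]negbK negb_exists; apply/negP => /forallP bs.
  suff: (mdeg b <= mdeg s)%N by lia.
  by rewrite !mdegE; apply: leq_sum => i _; rewrite leqNgt.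
have [k kl] := exists_other l.
have sums s' b' : (mdeg s' + e.+1)%N = d -> mdeg b' = d.+1 -> (0 < b' l)%N ->
    generated (coord s' b' - quot_coef l (coord^~ (U_(k) + (b' - U_(l)))%MM) (s' + U_(k))%MM).
  move=> sd' bd' bl; have le : (U_(l) <= b')%MM by rewrite lep1mP -lt0n.
  have bE : (U_(l) + (b' - U_(l)))%MM = b' by rewrite addmC submK.
  have td : mdeg (b' - U_(l)) = d by apply: succn_inj; rewrite -bd' -{2}bE mdegD mdeg1.
  have ltd : (mdeg s' < d)%N by lia.
  rewrite -{1}bE (coord_move k l ltd td) addrC addKr.
  apply: generated_sum => u; rewrite mem_top_terms => /eqP ud.
  have kd : (mdeg (s' + U_(k)) + e)%N = d by rewrite mdegD mdeg1; lia.
  apply: generatedB; (apply: generatedM; first by apply: IHe; rewrite // mdegD mdeg1 ud).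
  - by exists (tvar u (U_(k) + (b' - U_(l)))%MM); rewrite of_top_var // mdegD mdeg1 td.
  - by exists (tvar u (U_(l) + (b' - U_(l)))%MM); rewrite of_top_var // mdegD mdeg1 td.
move: {1}(s l) (erefl (s l)) => c; elim: c s b sd bd slb => [|c IHc] s b sd bd slb sl.
  have := sums s b sd bd (leq_ltn_trans (leq0n _) slb).
  by rewrite /quot_coef mnmDE mnm1E (negbTE kl) addn0 -sl /= subr0.
have bl := leq_ltn_trans (leq0n _) slb.
rewrite -[coord s b](subrK (quot_coef l (coord^~ (U_(k) + (b - U_(l)))%MM) (s + U_(k))%MM)).
apply: generatedD; first exact: sums.
rewrite /quot_coef mnmDE mnm1E (negbTE kl) addn0 -sl /=.
have le : (U_(l) <= s)%MM by rewrite lep1mP -sl.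
apply: IHc.
- suff -> : mdeg (s + U_(k) - U_(l)) = mdeg s by [].
  have : (mdeg (s + U_(k) - U_(l)) + mdeg U_(l) = mdeg s + mdeg U_(k))%N.
    by rewrite -!mdegD submK // (lepm_trans le) // lem_addr.
  by rewrite !mdeg1 => /addIn.
- have bE : (U_(l) + (b - U_(l)))%MM = b by rewrite addmC submK ?lep1mP -?lt0n.
  by rewrite -bd -{2}bE !mdegD !mdeg1.
- rewrite mnmBE !mnmDE mnmBE !mnm1E eqxx (negbTE kl); lia.
- by rewrite mnmBE mnmDE !mnm1E eqxx (negbTE kl) addn0 -sl subn1.
Qed.

Lemma of_top_surj f : exists f', of_top f' = pr f.
Proof.
have genX i : generated (pr 'X_i).
  case/mxvec_indexP: i => i j; rewrite -var_tnth ?uO ?uB //.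
  have := mem_tnth i (in_tuple O); rewrite mem_simplicial => sd.
  have := mem_tnth j (in_tuple B); rewrite mem_border => /eqP bd.
  by apply: (@coord_generated (d - mdeg (tnth (in_tuple O) i))) => //; rewrite subnKC.
have gen1 : generated 1 by exists 1; rewrite rmorph1.
rewrite (mpolyE f) rmorph_sum; apply: generated_sum => m _.
rewrite -mul_mpolyC rmorphM; apply: generatedM; first by exists (f@_m)%:MP; rewrite of_topC.
rewrite mpolyXE_id rmorph_prod; elim/big_ind: _ => //; first exact: generatedM.
move=> i _; rewrite rmorphXn; elim: (m i) => [|a IHa]; first by rewrite expr0.
by rewrite exprS; exact: generatedM (genX i) IHa.
Qed.

(** The value of [c(s, x_l t)] given by [coord_move] when [x_l] does not divide [s]. *)
Definition relator (k l : 'I_n) (s t : mon) : KT :=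
  \sum_(u <- T) (tvar (s + U_(k))%MM (U_(l) + u)%MM * tvar u (U_(k) + t)%MM -
                 tvar (s + U_(k))%MM (U_(k) + u)%MM * tvar u (U_(l) + t)%MM).

Lemma of_top_relator (k l : 'I_n) (s t : mon) : k != l -> s l = 0%N ->
  mdeg s = d.-1 -> (0 < d)%N -> mdeg t = d ->
  of_top (relator k l s t) = coord s (U_(l) + t)%MM.
Proof.
move=> kl sl sd d0 td.
have sd' : (mdeg s < d)%N by rewrite sd prednK.
rewrite (coord_move k l sd' td) /quot_coef mnmDE mnm1E (negbTE kl) addn0 sl add0r.
rewrite rmorph_sum big_seq [RHS]big_seq; apply: eq_bigr => u.
rewrite mem_top_terms => /eqP ud.
by rewrite rmorphB !rmorphM !of_top_var // mdegD mdeg1 ?td ?ud ?sd ?addn1 ?prednK.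
Qed.

(** Take [s = y^(d-1)] and [t = x^d].  The coordinate [c(s, x t)] is computed by moving [x]
    to [y] and also by moving [x] to [z].  The two results differ as polynomials: at the
    point where [c(y^d, y x^d)] and [c(y^d, x y^d)] are 1 and all other coordinates of top
    degree are 0, the first is 1 and the second 0. *)
Lemma top_relation (x y z : 'I_n) : (0 < d)%N -> x != y -> x != z -> y != z ->
  exists2 F : KT, F != 0 & of_top F = 0.
Proof.
move=> d0 xy xz yz.
pose s := (U_(y) *+ d.-1)%MM; pose t := (U_(x) *+ d)%MM; pose q := (U_(y) *+ d)%MM.
have sy : (s + U_(y))%MM = q by rewrite -mulmSr prednK.
have sd : mdeg s = d.-1 by rewrite mdegMn mdeg1 mul1n.
have td : mdeg t = d by rewrite mdegMn mdeg1 mul1n.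
have qT : q \in T by rewrite mem_top_terms mdegMn mdeg1 mul1n.
have sx : s x = 0%N by rewrite mulmnE mnm1E eq_sym (negbTE xy).
exists (relator y x s t - relator z x s t); last first.
  have yx : y != x by rewrite eq_sym.
  have zx : z != x by rewrite eq_sym.
  apply/eqP; rewrite rmorphB subr_eq0; apply/eqP.
  exact: etrans (of_top_relator yx sx sd d0 td) (esym (of_top_relator zx sx sd d0 td)).
(* The point at which the two expressions differ. *)
pose w (s' b : mon) : K := ((s' == q) && ((b == U_(y) + t) || (b == U_(x) + q))%MM)%:R.
have [h h_var] : exists h : {rmorphism KT -> K},
    forall s' b, mdeg s' = d -> mdeg b = d.+1 -> h (tvar s' b) = w s' b.
  exists (mmap idfun (point w)) => s' b s'd bd; rewrite /= mmap_var ?uT ?uB //.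
    by rewrite mem_top_terms s'd.
  by rewrite mem_border bd.
have h_relator k : k != x -> h (relator k x s t) = (k == y)%:R.
  move=> kx; rewrite rmorph_sum.
  rewrite (eq_big_seq (fun u => (u == q)%:R * (k == y)%:R)).
    by rewrite sum_delta ?uT // qT.
  move=> u; rewrite mem_top_terms => /eqP ud.
  have w0 u' : w u' (U_(x) + t)%MM = 0.
    rewrite /w; case: eqP => //= _; case: orP => // -[] /eqP/mnmP/(_ y).
      by rewrite !mnmDE !mulmnE !mnm1E eqxx (negbTE xy) mul0n.
    by rewrite !mnmDE !mulmnE !mnm1E eqxx (negbTE xy) mul0n mul1n; case: (d) d0.
  rewrite rmorphB !rmorphM !h_var ?mdegD ?mdeg1 ?td ?ud ?sd ?addn1 ?prednK //.
  rewrite w0 mulr0 subr0.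
  have [->|ky] := eqVneq k y.
    rewrite sy /w eqxx; have [->|uq] := eqVneq u q; last by rewrite /= !mulr0n mulr0 mul0r.
    by rewrite !eqxx orbT !mulr1.
  have yk : (y == k) = false by rewrite eq_sym (negbTE ky).
  have xk : (x == k) = false by rewrite eq_sym (negbTE kx).
  have -> : w u (U_(k) + t)%MM = 0.
    rewrite /w; case: orP => [[] /eqP/mnmP/(_ k)|]; last by rewrite andbF.
      by rewrite !mnmDE !mulmnE !mnm1E eqxx yk xk.
    by rewrite !mnmDE !mulmnE !mnm1E eqxx yk xk.
  by rewrite mulr0n !mulr0.
have yx : y != x by rewrite eq_sym.
have zx : z != x by rewrite eq_sym.
have zy : (z == y) = false by rewrite eq_sym (negbTE yz).
have hF : h (relator y x s t - relator z x s t) = 1.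
  have -> : 1 = (y == y)%:R - (z == y)%:R :> K by rewrite eqxx zy subr0.
  rewrite rmorphB; congr (_ - _); exact: h_relator.
by apply/eqP => F0; move: hF; rewrite F0 rmorph0 => /esym/eqP; rewrite oner_eq0.
Qed.

End TopCoordinates.

(** * Tangent vectors at the monomial point *)

Section TangentVectors.
Variables (K : fieldType) (n d : nat).
Local Notation O := (simplicial n d).
Local Notation B := (border O).
Local Notation T := (top_terms n d).
Local Notation KC := {mpoly K[size O * size B]}.
Local Notation A := (coord_ring K n d).
Local Notation mon := 'X_{1..n}.
Local Notation cvar := (var K O B).
Local Notation pr := (@proj K n d).
Local Notation L := (monomial_point_local_ring K n d).
Local Notation uO := (simplicial_uniq n d).
Local Notation uB := (border_uniq n d).

Section Direction.
Variables (s0 b0 : mon).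
Hypothesis s0d : mdeg s0 = d.

(** The line through the origin in the direction of the coordinate [c(s0, b0)]; the
    coefficient of ['X] is the derivative at the origin in that direction. *)
Definition line : KC -> {poly K} :=
  mmap (@polyC K) (point (fun s b => ((s == s0) && (b == b0))%:R *: 'X)).
HB.instance Definition _ := GRing.RMorphism.on line.

Lemma line_var s b : mdeg s = d -> mdeg b = d.+1 ->
  line (cvar s b) = ((s == s0) && (b == b0))%:R *: 'X.
Proof.
move=> sd bd; rewrite /line mmap_var ?uO ?uB //.
  by rewrite mem_simplicial sd.
by rewrite mem_border bd.
Qed.

Lemma line_low s b : (mdeg s < d)%N -> line (cvar s b) = 0.
Proof.
move=> sd; have [bB|/varNr ->] := boolP (b \in B); last by rewrite rmorph0.
rewrite /line mmap_var ?uO ?uB ?mem_simplicial 1?ltnW //.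
by case: eqP => [ss0|_]; rewrite ?scale0r //; rewrite ss0 s0d ltnn in sd.
Qed.

Lemma line_coef0 f : (line f)`_0 = f.@[@origin K n d].
Proof.
rewrite -horner_coef0 -/(horner_eval 0 _).
apply: (@eq_rmorph_var _ _ _ _ uO uB _ (horner_eval 0 \o line) (meval (@origin K n d))).
  by move=> c; rewrite /= /line mmapC mevalC /horner_eval hornerC.
move=> s b sO bB; have [i [j [_ _ e]]] := var_index K uO uB sO bB.
rewrite /= [in RHS]e mevalXU /line mmap_var ?uO ?uB //.
by rewrite /horner_eval hornerZ hornerX mulr0.
Qed.

(** All coordinates [c(s, b)] with [deg s < d] vanish on the line and those with
    [deg s = d] are multiples of the parameter, so only the quadratic part remains. *)
Lemma line_top_product k l p t : (mdeg p <= d)%N -> mdeg t = d ->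
  exists q, top_product line k l p t = q * 'X^2.
Proof.
move=> pd td.
have q0 : quot_coef k (fun s => line (cvar s (U_(l) + t)%MM)) p = 0.
  rewrite /quot_coef; case: eqP => // pk; apply: line_low.
  have le : (U_(k) <= p)%MM by rewrite lep1mP; apply/eqP.
  by move: pd; rewrite -{1}(submK le) mdegD mdeg1 addn1.
have scal s b : (mdeg s <= d)%N -> mdeg b = d.+1 ->
    exists c, line (cvar s b) = c *: 'X.
  rewrite leq_eqVlt => /orP[/eqP sd|/line_low ->] bd; last by exists 0; rewrite scale0r.
  by exists ((s == s0) && (b == b0))%:R; rewrite line_var.
rewrite /top_product q0 add0r big_seq /=.
elim/big_rec: _ => [|u x]; first by exists 0; rewrite mul0r.
rewrite mem_top_terms => /eqP ud [q ->].
have [c1 ->] : exists c, line (cvar p (U_(k) + u)%MM) = c *: 'X.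
  by apply: scal => //; rewrite mdegD mdeg1 ud.
have [c2 ->] : exists c, line (cvar u (U_(l) + t)%MM) = c *: 'X.
  by apply: scal; rewrite ?ud // mdegD mdeg1 td.
exists ((c1 * c2)%:P + q).
by rewrite mulrDl mul_polyC -scalerAl -scalerAr scalerA -expr2.
Qed.

Lemma line_commutator k l i j : exists q, line (commutator K O k l i j) = q * 'X^2.
Proof.
have := mem_tnth j (in_tuple O); rewrite mem_simplicial leq_eqVlt.
case/orP => [/eqP jd|jd]; last by exists 0; rewrite commutator_low // mul0r.
have pd : (mdeg (tnth (in_tuple O) i) <= d)%N by rewrite -mem_simplicial mem_tnth.
rewrite commutator_top //.
have [q1 ->] := line_top_product k l pd jd; have [q2 ->] := line_top_product l k pd jd.
by exists (q1 - q2); rewrite mulrBl.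
Qed.

Lemma line_ideal f : in_border_ideal f -> (line f)`_1 = 0.
Proof.
case=> a ->; suff [q ->] : exists q, line (\sum_k \sum_l \sum_i \sum_j
    a k l i j * commutator K O k l i j) = q * 'X^2 by rewrite coefMXn.
pose Q (p : {poly K}) := exists q, p = q * 'X^2.
have QD : forall p p', Q p -> Q p' -> Q (p + p').
  by move=> _ _ [p ->] [p' ->]; exists (p + p'); rewrite mulrDl.
have Q0 : Q 0 by exists 0; rewrite mul0r.
rewrite rmorph_sum; apply: (big_ind Q) => // k _.
rewrite rmorph_sum; apply: (big_ind Q) => // l _.
rewrite rmorph_sum; apply: (big_ind Q) => // i _.
rewrite rmorph_sum; apply: (big_ind Q) => // j _.
have [q e] := line_commutator k l i j.
by exists (line (a k l i j) * q); rewrite rmorphM /= e mulrA.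
Qed.

Definition tangent (x : A) : K := (line (repr x))`_1.

Lemma tangentE f : tangent (pr f) = (line f)`_1.
Proof.
have : pr (repr (pr f)) = pr f by exact: reprK.
move=> /eqP; rewrite -Quotient.idealrBE => /border_idealP/line_ideal.
by rewrite rmorphB coefB => /eqP; rewrite subr_eq0 => /eqP.
Qed.

Lemma tangentD x y : tangent (x + y) = tangent x + tangent y.
Proof.
by rewrite -(proj_repr x) -(proj_repr y) -rmorphD !tangentE rmorphD coefD.
Qed.

Lemma tangentM x y :
  tangent (x * y) = eval_origin x * tangent y + tangent x * eval_origin y.
Proof.
rewrite -(proj_repr x) -(proj_repr y) -rmorphM !tangentE !eval_originE rmorphM.
by rewrite coefM big_ord_recl big_ord1 /= !line_coef0.
Qed.

Definition eval_loc (x : L) : K :=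
  eval_origin (repr x).1 / eval_origin (sval (repr x).2).
(** The quotient rule at an element of the maximal ideal, where the numerator vanishes at
    the origin; elsewhere the value has no meaning. *)
Definition tangent_loc (x : L) : K :=
  tangent (repr x).1 / eval_origin (sval (repr x).2).

Lemma eval_origin_denom (s : denom (@origin_ideal K n d)) : eval_origin (sval s) != 0.
Proof. exact: valP s. Qed.

Lemma eval_originM (x y : A) : eval_origin (x * y) = eval_origin x * eval_origin y.
Proof.
by rewrite -(proj_repr x) -(proj_repr y) -rmorphM !eval_originE rmorphM.
Qed.

Lemma tangent_loc_frac a s : a \in @origin_ideal K n d ->
  tangent_loc (frac a s : L) = tangent a / eval_origin (sval s).
Proof.
move=> aI; have a'I : (repr (frac a s)).1 \in @origin_ideal K n d.
  by move: aI; rewrite -(frac_in_max a s) unfold_in.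
have [u] := repr_frac a s; rewrite /tangent_loc.
move: (repr (frac a s)) a'I => [a' s'] /= a'I.
rewrite mulrBr => /eqP; rewrite subr_eq0 => /eqP/(congr1 tangent).
rewrite !tangentM !eval_originM (eqP a'I) (eqP aI) !mul0r !mulr0 !add0r !addr0.
move/(mulfI (eval_origin_denom u)) => e.
apply/eqP; rewrite eqr_div ?eval_origin_denom //; apply/eqP.
by rewrite e.
Qed.

Lemma tangent_locD : {in @loc_max _ (@origin_ideal K n d) &,
  {morph tangent_loc : x y / x + y}}.
Proof.
move=> x y; rewrite -(fracE x) -(fracE y) !frac_in_max => xI yI.
rewrite frac_add !tangent_loc_frac //; last first.
  by rewrite rpredD // mulrC idealMr.
rewrite tangentD !tangentM (eqP xI) (eqP yI) !mul0r !add0r eval_originM.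
by rewrite -addf_div ?eval_origin_denom.
Qed.

Lemma tangent_locM (b : L) : {in @loc_max _ (@origin_ideal K n d),
  forall x, tangent_loc (b * x) = eval_loc b * tangent_loc x}.
Proof.
move=> x; rewrite -(fracE x) frac_in_max => xI.
rewrite -{1}(fracE b) frac_mul !tangent_loc_frac ?idealMr //.
by rewrite tangentM (eqP xI) mulr0 addr0 eval_originM mulf_div.
Qed.

Lemma eval_loc_max : {in @loc_max _ (@origin_ideal K n d), forall x, eval_loc x = 0}.
Proof. by move=> x /eqP xI; rewrite /eval_loc xI mul0r. Qed.

End Direction.

End TangentVectors.

(** * Singularity of the monomial point *)

Section Singularity.
Variables (K : fieldType) (n d : nat).
Local Notation O := (simplicial n d).
Local Notation B := (border O).
Local Notation T := (top_terms n d).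
Local Notation KC := {mpoly K[size O * size B]}.
Local Notation KT := {mpoly K[size T * size B]}.
Local Notation A := (coord_ring K n d).
Local Notation mon := 'X_{1..n}.
Local Notation cvar := (var K O B).
Local Notation pr := (@proj K n d).
Local Notation L := (monomial_point_local_ring K n d).
Local Notation N := (size T * size B)%N.
Local Notation loc := (@to_loc _ (@origin_ideal K n d)).

(** The derivatives along the [N] coordinate lines of top degree are dual to these
    coordinates. *)
Lemma cotangent_dim_top (m : idealr L) e :
  unique_maximal_ideal m -> cotangent_dim m e -> (N <= e)%N.
Proof.
move=> [_ m_unique].
have mE : @loc_max _ (@origin_ideal K n d) =i m by apply: m_unique; exact: loc_max_maximal.
pose s_of (w : 'I_N) : mon := point (fun s _ => s) w.
pose b_of (w : 'I_N) : mon := point (fun _ b => b) w.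
have s_ofd w : mdeg (s_of w) = d.
  rewrite /s_of; case/mxvec_indexP: w => i j; rewrite pointE; apply/eqP.
  by rewrite -mem_top_terms mem_tnth.
have b_ofd w : mdeg (b_of w) = d.+1.
  rewrite /b_of; case/mxvec_indexP: w => i j; rewrite pointE; apply/eqP.
  by rewrite -mem_border mem_tnth.
have sb_of w v : (s_of v == s_of w) && (b_of v == b_of w) = (w == v).
  rewrite /s_of /b_of; case/mxvec_indexP: w => i j; case/mxvec_indexP: v => i' j'.
  rewrite !pointE !tnth_uniq_eq ?top_uniq ?border_uniq //.
  apply/andP/eqP => [[/eqP -> /eqP ->] //|e1].
  have [g gK _] := curry_mxvec_bij (size T) (size B).
  have := gK (i, j) isT; rewrite /= e1 => e2.
  by have := gK (i', j') isT; rewrite /= e2 => -[-> ->]; rewrite !eqxx.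
pose y w : L := loc (pr (cvar (s_of w) (b_of w))).
have yI w : pr (cvar (s_of w) (b_of w)) \in @origin_ideal K n d.
  apply/eqP; rewrite eval_originE -(line_coef0 (s_of w) (b_of w)).
  by rewrite line_var // coefZ coefX mulr0.
apply: (cotangent_dim_ge (ev := @eval_loc K n d)
  (D := fun w => @tangent_loc K n d (s_of w) (b_of w)) (y := y)).
- by move=> w a b; rewrite -!mE; exact: tangent_locD.
- by move=> w b a; rewrite -mE; exact: tangent_locM.
- by move=> a; rewrite -mE; exact: eval_loc_max.
- by move=> w; rewrite -mE frac_in_max.
move=> w v; rewrite /y tangent_loc_frac // tangentE // line_var //.
have ev1 : eval_origin (1 : A) = 1 by rewrite -(rmorph1 pr) eval_originE rmorph1.
by rewrite coefZ coefX mulr1 sb_of /= ev1 divr1.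
Qed.

Lemma singular_of_three : (0 < d)%N -> (3 <= n)%N -> monomial_point_singular K n d.
Proof.
move=> d0 n3 [_ [m m_max [e cot_e [[c chain] _]]]].
have Ne := cotangent_dim_top m_max cot_e.
have [h [hC h_var]] := exists_of_top (@proj K n d).
have n2 : (1 < n)%N := ltnW n3.
have surj := of_top_surj (@proj_ideal K n d) hC h_var n2.
have [F F0 hF] := @top_relation K n d _ _ (@proj_ideal K n d) _ h_var
  (Ordinal (ltnW n2)) (Ordinal n2) (Ordinal n3) d0 isT isT isT.
pose P i := c (inord i).
have P_lt i : (i < N)%N -> {subset P i <= P i.+1} /\ ~ {subset P i.+1 <= P i}.
  move=> iN; apply: chain; rewrite !inordK //; lia.
(* A unit multiple of an element of the local ring comes from the coordinate ring, hence
   from a polynomial in the generators. *)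
have /choice[f fP] : forall i, exists f, (i < N)%N ->
    loc (h f) \in P i.+1 /\ loc (h f) \notin P i.
  move=> i; have [iN|iN] := boolP (i < N)%N; last by exists 0.
  have [_ /existsNP[x /not_implyP[xin /negP xnin]]] := P_lt i iN.
  have [f hf] := surj (repr (repr x).1).
  rewrite /= proj_repr in hf; exists f => _; rewrite hf (clear_denom _ (repr x).2) fracE.
  split; first exact: idealMr.
  rewrite prime_idealrM negb_or xnin andbT; apply/negP => dP.
  have : 1 \in P i by rewrite -(to_loc_denomK (repr x).2) idealMr.
  by rewrite idealr1.
apply: (@no_long_chain K N L (loc \o h) F P f F0) => //.
- by rewrite /= hF rmorph0.
- by move=> i /P_lt[].
Qed.
End Singularity.

Theorem proposition5p6 (K : fieldType) (n d : nat) (hd : (1 <= d)%N) :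
  (n = 2%N ->
     exists phi : {lrmorphism coord_ring K n d -> {mpoly K[d.+1 * d.+2]}},
       bijective phi)
  /\ ((3 <= n)%N -> monomial_point_singular K n d).
Proof.
split=> [->|n3]; first exact: coord_ring_plane.
exact: singular_of_three.
Qed.
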